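(* Let $\{\mu_\theta\}_{\theta\in\Theta}$ be a family of Borel probability measures on $\mathbb{R}^d$ and let $\mu_{\mathrm{mix}}$ be its mixture with respect to a mixing probability measure $m$ on $\Theta$. Suppose that the measures $\mu_\theta$ satisfy the $\overline{\mathbf{T}}_2^-$ inequality with uniformly bounded constants: $$C_\Theta := \sup_{\theta\in\Theta} C_{\overline{\mathbf{T}}_2^-}(\mu_\theta)<\infty .$$ Suppose moreover that $$D_\Theta := \sup_{\theta,\theta'\in\Theta}\overline{\mathcal{T}}_2(\mu_\theta|\mu_{\theta'})<\infty .$$ Then $\mu_{\mathrm{mix}}$ satisfies the $\overline{\mathbf{T}}_2^-$ inequality and $$C_{\overline{\mathbf{T}}_2^-}(\mu_{\mathrm{mix}})\le\max\{2C_\Theta,\,4D_\Theta\}.$$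
   Context: Mixture: $(\Theta,\mathfrak{M},m)$ is a probability space, for every Borel set $A\subset\mathbb{R}^d$ the map $\theta\mapsto\mu_\theta(A)$ is measurable, and $\mu_{\mathrm{mix}}(A):=\int_\Theta \mu_\theta(A)\,dm(\theta)$ for Borel $A\subset\mathbb{R}^d$. $|\cdot|$ is the Euclidean norm; $\mathcal{P}_1(\mathbb{R}^d)$ is the set of Borel probability measures on $\mathbb{R}^d$ with finite first moment. Relative entropy: $H(\nu|\mu):=\int\log\bigl(\frac{d\nu}{d\mu}\bigr)d\nu$ if $\nu\ll\mu$ and $+\infty$ otherwise. Weak quadratic transport cost: for probability measures $\mu_1,\mu_2$ on $\mathbb{R}^d$ with $\mu_2\in\mathcal{P}_1(\mathbb{R}^d)$, $$\overline{\mathcal{T}}_2(\mu_2|\mu_1):=\inf_\pi\int_{\mathbb{R}^d}\tfrac12\Bigl|x-\int_{\mathbb{R}^d}y\,p_x(dy)\Bigr|^2\mu_1(dx),$$ where the infimum is over all couplings $\pi$ of $\mu_1$ and $\mu_2$, and $p_x$ is defined ($\mu_1$-a.s.) by $\pi(dx\,dy)=p_x(dy)\mu_1(dx)$. Equivalently, it is the infimum of $\frac12\mathbb{E}|X_1-\mathbb{E}[X_2|X_1]|^2$ over pairs $(X_1,X_2)$ with $X_1\sim\mu_1$, $X_2\sim\mu_2$. A probability measure $\mu$ (with finite first moment) satisfies $\overline{\mathbf{T}}_2^-$ with constant $C\in(0,\infty)$ if $\overline{\mathcal{T}}_2(\mu|\nu)\le C\,H(\nu|\mu)$ for all $\nu\in\mathcal{P}_1(\mathbb{R}^d)$.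 $C_{\overline{\mathbf{T}}_2^-}(\mu)$ is the best such constant (infimum; $+\infty$ if there is none). *)

(* Defs.v *)
From HB Require Import structures.
From mathcomp Require Import all_boot all_order all_algebra.
From mathcomp Require Import all_classical all_reals all_analysis.
From mathcomp Require Import measurable_realfun.

Set Implicit Arguments.
Unset Strict Implicit.
Unset Printing Implicit Defensive.

Import Order.TTheory GRing.Theory Num.Theory.
Import numFieldNormedType.Exports.

Local Open Scope classical_set_scope.
Local Open Scope ring_scope.

(* R^d with its Borel sets: the topology of 'rV[R]_d is the one of the
   sup norm, which is also the Euclidean one. *)
Notation Rd R d := (g_sigma_algebraType (@open 'rV[R]_d)).

(* The library's norm `|x| on 'rV[R]_d is the sup norm. *)
Definition eucl_norm (R : realType) (d : nat) (x : 'rV[R]_d) : R :=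
  Num.sqrt (\sum_(i < d) x 0 i ^+ 2).

Section mixture.
Context (R : realType) (d : nat) (dT : measure_display)
  (Theta : measurableType dT) (m : probability Theta R)
  (mu : Theta -> probability (Rd R d) R).
Local Open Scope ereal_scope.

Definition measurable_family := forall A : set (Rd R d),
  measurable A -> measurable_fun [set: Theta] (fun t => mu t A).

(* The measurability proof is a parameter so that the mixture is canonically a
   probability measure. *)
Definition mixture (hmu : measurable_family) (A : set (Rd R d)) : \bar R :=
  \int[m]_t mu t A.

Context (hmu : measurable_family).

Let mixture0 : mixture hmu set0 = 0.
Proof. by apply: integral0_eq => t _; rewrite measure0. Qed.

Let mixture_ge0 A : 0 <= mixture hmu A.
Proof. by apply: integral_ge0 => t _. Qed.

Let mixture_sigma_additive : semi_sigma_additive (mixture hmu).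
Proof.
move=> F mF tF mUF; rewrite [X in _ --> X](_ : _ =
    \sum_(0 <= n <oo) \int[m]_t mu t (F n)).
  by apply: is_cvg_ereal_nneg_natsum_cond => n _ _; exact: mixture_ge0.
rewrite -integral_nneseries//; last by move=> n; exact: hmu.
apply: eq_integral => t _; exact: measure_semi_bigcup.
Qed.

HB.instance Definition _ := isMeasure.Build _ _ _ (mixture hmu)
  mixture0 mixture_ge0 mixture_sigma_additive.

Let mixture_setT : mixture hmu [set: Rd R d] = 1.
Proof.
transitivity (\int[m]_t (cst 1 t : \bar R)).
  by apply: eq_integral => t _; exact: probability_setT.
by rewrite integral_cst// mul1e; exact: probability_setT.
Qed.

HB.instance Definition _ :=
  Measure_isProbability.Build _ _ _ (mixture hmu) mixture_setT.

End mixture.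

Section weak_transport.
Context (R : realType) (d : nat).
Implicit Types mu nu : probability (Rd R d) R.
Local Open Scope charge_scope.
Local Open Scope ereal_scope.

Definition P1 mu := \int[mu]_x (eucl_norm x)%:E < +oo.

Definition rel_entropy nu mu : \bar R :=
  if `[< nu `<< mu >]
  then \int[nu]_x lne (('d (charge_of_finite_measure nu) '/d mu) x)
  else +oo.

Definition coupling mu1 mu2
    (pi : probability (Rd R d * Rd R d)%type R) :=
  (forall A, measurable A -> pi (A `*` setT) = mu1 A) /\
  (forall B, measurable B -> pi (setT `*` B) = mu2 B).

(* pi(dx dy) = p_x(dy) mu1(dx) *)
Definition disintegration mu1 (pi : probability (Rd R d * Rd R d)%type R)
    (p : R.-pker Rd R d ~> Rd R d) :=
  forall A B, measurable A -> measurable B ->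
    pi (A `*` B) = \int[mu1]_(x in A) p x B.

(* The library's integral is total: the value is meaningful when q has a finite
   first moment, which holds for mu1-almost every p_x as soon as P1 mu2. *)
Definition barycenter (q : {measure set Rd R d -> \bar R}) : 'rV[R]_d :=
  \row_(i < d) (\int[q]_y (y : 'rV[R]_d) 0%R i)%R.

(* [weak_cost mu2 mu1] is the cost written T2(mu2 | mu1): the conditioning is on
   the marginal of the second argument. *)
Definition weak_cost mu2 mu1 : \bar R :=
  ereal_inf [set c | exists (pi : probability (Rd R d * Rd R d)%type R)
                            (p : R.-pker Rd R d ~> Rd R d),
    [/\ coupling mu1 mu2 pi, disintegration mu1 pi p &
      c = \int[mu1]_x
            (2^-1 * eucl_norm ((x : 'rV[R]_d) - barycenter (p x)) ^+ 2)%:E]].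

Definition T2minus mu (C : R) :=
  P1 mu /\
  forall nu, P1 nu -> weak_cost mu nu <= C%:E * rel_entropy nu mu.

(* The infimum of the empty set is +oo. *)
Definition T2minus_const mu : \bar R :=
  ereal_inf [set C%:E | C in [set C : R | (0 < C)%R /\ T2minus mu C]].

End weak_transport.

(* Main.v *)
Require Import Defs.
From HB Require Import structures.
From mathcomp Require Import all_boot all_order all_algebra.
From mathcomp Require Import all_classical all_reals all_analysis.
From mathcomp Require Import measurable_realfun.
From mathcomp Require Import ring lra.

(* By Kantorovich-type duality, the weak cost is governed by the functions
   phi_s(x) = sup_u (<u, x> - G u - s |u|^2): if a weak coupling of alpha and beta
   has cost T, then for p in [0, 1]
     int phi_(s+a) dalpha <= (1 - p) int phi_s dalpha + p int phi_s dbeta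
                             + p^2 T / (2a).
   Given nu = f mu_mix, put w(t) = int f dmu_t and nu_t = f mu_t / w(t).  Transport
   nu_t to mu_t with the T2 inequality of mu_t (p = 1, half of the quadratic term),
   then mu_t to any mu_t' with p = (1 - 1/w(t))_+, which is Marton's optimal coupling
   of w m and m; since w p^2 <= 2 (w ln w - w + 1), the chain rule for the entropy
   gives  int phi_a dnu <= int phi_0 dmu_mix + K H(nu|mu_mix) / (2a)  whenever
   K >= max(2C, 4D).  Being a statement about numbers t |-> int phi dmu_t, this
   needs no measurable selection of couplings.

   Such dual inequalities imply weak_cost mu nu <= K H: quantize mu by finitely
   many cells, and minimize, up to a small error, the cost plus a penalty on the
   second marginal over measurable simplex-valued weights.  The first-order
   condition, tested against the best cell at each point, produces a function G for
   which the dual inequality bounds cost and penalty; the small defect of the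
   marginal is then repaired. *)

Set Implicit Arguments.
Unset Strict Implicit.
Unset Printing Implicit Defensive.

Import Order.TTheory GRing.Theory Num.Theory.
Import numFieldNormedType.Exports.

Local Open Scope classical_set_scope.
Local Open Scope ring_scope.
Local Open Scope ereal_scope.

(** * Entropy and densities *)

(** The constants 2C and 4D come from giving half of the quadratic term a to each stage. The first
    stage then costs T / a with T <= C H_t, where H_t is the entropy of nu_t; the second costs p^2 D
    / a. After multiplication by w these are at most C w H_t / a and 2 D [entf w] / a, and both fit
    under K / (2a) times the respective entropy exactly when 2C <= K and 4D <= K.

    The return from the dual inequality to an actual coupling takes place in L^2, so second moments
    must be extracted from hypotheses that mention first moments only. For the mu_t they follow from
    the T2 inequality tested on exponentially tilted measures, with a bound uniform in t; for a nu
    of finite entropy they follow from the dual inequality itself with a quadratic G.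

    Finitely many cells and almost minimizers take the place of compactness: no optimal coupling,
    optimal potential or limit of couplings is ever extracted. The quantization error is absorbed by
    a small part kap |u|^2 of the quadratic term, set aside for that purpose. *)

Section entropy_function.
Context {R : realType}.
Implicit Types t w : R.
Local Open Scope ring_scope.

(* [ln 0 = 0], so that [entf 0 = 1]. *)
Definition entf t : R := t * ln t - t + 1.

Lemma entf_ge0 t : 0 <= t -> 0 <= entf t.
Proof.
rewrite le_eqVlt => /predU1P[<-|t0]; first by rewrite /entf mul0r subr0 add0r.
have h : ln t^-1 <= t^-1 - 1.
  have -> : t^-1 = 1 + (t^-1 - 1) by rewrite addrC subrK.
  rewrite (le_trans (le_ln1Dx _))//; first by rewrite ltrBrDr addrC subrr invr_gt0.
  by rewrite addrAC subrr add0r.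
rewrite lnV ?posrE// in h.
have := ler_wpM2l (ltW t0) h; rewrite mulrN mulrBr divff ?gt_eqF// mulr1 /entf; lra.
Qed.

(** Divided by w^2, the right side minus the left side is the function [f] below, which vanishes at
    1 and has derivative 2 t^-1 (1 - t^-1)^2 >= 0. With p = 1 - 1/w the inequality reads w p^2 <= 2
    [entf w]: the quadratic price of the moved mass is paid by the entropy of w. *)
Lemma entf_ge_marton w : 1 <= w -> (w - 1) ^+ 2 <= 2 * w * entf w.
Proof.
rewrite le_eqVlt => /predU1P[<-|w1].
  by rewrite /entf ln1; lra.
pose f t : R := 2 * ln t - 3 + 4 * t^-1 - t^-1 ^+ 2.
pose df t : R := 2 * t^-1 - 4 * t^-1 ^+ 2 + 2 * t^-1 ^+ 3.
have t0 t : 1 <= t -> 0 < t by move=> h; exact: lt_le_trans h.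
have fd t : 1 <= t -> is_derive t 1 f (df t).
  move=> /t0 t_gt0.
  have ? : is_derive t 1 (@ln R) t^-1 by exact: is_derive1_ln.
  have tn0 : t != 0 by rewrite gt_eqF.
  have ? : is_derive t 1 (fun x : R => x^-1) (- (t^-1) ^+ 2).
    have h := @is_deriveV R (fun x : R => x) t 1 1 tn0 (is_derive_id _ _).
    by apply: (is_derive_eq h); rewrite /GRing.scale/= mulr1 exprVn.
  apply: is_derive_eq.
  rewrite /df /GRing.scale/=; ring.
have cf : {within `[1, w], continuous f}.
  apply: derivable_within_continuous => x; rewrite in_itv/= => /andP[x1 _].
  by have [] := fd _ x1.
have fd' x : x \in `]1, w[ -> is_derive x 1 f (df x).
  by rewrite in_itv/= => /andP[/ltW/fd].
have [c] := MVT w1 fd' cf; rewrite in_itv/= => /andP[c1 _].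
have c0 : 0 < c by apply: t0; rewrite ltW.
have -> : f 1 = 0 by rewrite /f ln1 invr1; lra.
rewrite subr0 => fw.
have : 0 <= f w.
  rewrite fw mulr_ge0 ?subr_ge0 ?(ltW w1)//.
  have -> : df c = 2 * c^-1 * (1 - c^-1) ^+ 2 by rewrite /df; ring.
  by rewrite mulr_ge0 ?sqr_ge0 ?mulr_ge0 ?invr_ge0 ?ltW.
have w0 : 0 < w by apply: t0; rewrite ltW.
move=> /(mulr_ge0 (sqr_ge0 w)).
have -> : w ^+ 2 * f w = 2 * w * entf w - (w - 1) ^+ 2.
  by rewrite /f /entf; field; rewrite gt_eqF.
by rewrite subr_ge0.
Qed.

(** Pointwise chain rule: when t has mean w, the correction in parentheses has mean [entf w]. *)
Lemma entf_scale t w : 0 <= t -> 0 < w ->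
  entf t = w * entf (t / w) + (t * ln w - w + 1).
Proof.
rewrite le_eqVlt => /predU1P[<-|t0] w0.
  by rewrite /entf !mul0r !subr0 !add0r mulr1; lra.
rewrite /entf ln_div ?posrE//; field.
by rewrite gt_eqF.
Qed.

End entropy_function.

Section density.
Context d (T : measurableType d) (R : realType).
Variables (mu : {measure set T -> \bar R}) (g : T -> R).

(* The proofs are parameters so that [density] is canonically a probability. *)
Definition density (g0 : forall x, (0 <= g x)%R) (mg : measurable_fun setT g)
  (g1 : \int[mu]_x (g x)%:E = 1) (A : set T) := \int[mu]_(x in A) (g x)%:E.

Variables (g0 : forall x, (0 <= g x)%R) (mg : measurable_fun setT g)
  (g1 : \int[mu]_x (g x)%:E = 1).
Local Notation dens := (density g0 mg g1).

Let mgE A : measurable A -> measurable_fun A (EFin \o g).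
Proof. by move=> mA; apply/measurable_EFinP; exact: measurable_funTS. Qed.

Let dens0 : dens set0 = 0. Proof. exact: integral_set0. Qed.

Let dens_ge0 A : 0 <= dens A.
Proof. by apply: integral_ge0 => x _; rewrite lee_fin. Qed.

Let dens_sigma_additive : semi_sigma_additive dens.
Proof.
move=> F mF tF mUF; rewrite /density ge0_integral_bigcup//.
- by apply: is_cvg_ereal_nneg_natsum_cond => n _ _; exact: dens_ge0.
- exact: mgE.
- by move=> x _; rewrite lee_fin.
Qed.

HB.instance Definition _ := isMeasure.Build _ _ _ dens
  dens0 dens_ge0 dens_sigma_additive.

HB.instance Definition _ := Measure_isProbability.Build _ _ _ dens g1.

End density.

Section change_of_density.
Local Open Scope charge_scope.
Local Open Scope ereal_scope.
Context d (T : measurableType d) (R : realType).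
Variables (mu nu : probability T R) (g : T -> R).
Hypotheses (g0 : forall x, (0 <= g x)%R) (mg : measurable_fun setT g)
  (nug : forall A, measurable A -> nu A = \int[mu]_(x in A) (g x)%:E).

Lemma dominates_of_density : nu `<< mu.
Proof.
apply/null_content_dominatesP => A mA muA0; rewrite nug//.
apply: null_set_integral => //.
by apply/measurable_EFinP; exact: measurable_funTS.
Qed.

Let F := Radon_Nikodym_SigmaFinite.f nu mu.
Let numu := dominates_of_density.

Let F_ae_eq : ae_eq mu setT F (EFin \o g).
Proof.
apply: integral_ae_eq => //.
- exact: Radon_Nikodym_SigmaFinite.f_integrable.
- exact/measurable_EFinP.
- by move=> A _ mA; rewrite -nug// (Radon_Nikodym_SigmaFinite.f_integral numu).
Qed.

Lemma ge0_integral_density h : measurable_fun setT h -> (forall x, 0 <= h x) ->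
  \int[nu]_x h x = \int[mu]_x (h x * (g x)%:E).
Proof.
move=> mh h0.
rewrite -(Radon_Nikodym_SigmaFinite.change_of_variables numu)//.
have mF := measurable_int _ (Radon_Nikodym_SigmaFinite.f_integrable numu).
apply: ae_eq_integral => //.
- exact: emeasurable_funM.
- by apply: emeasurable_funM => //; exact/measurable_EFinP.
- exact: ae_eqe_mul2l.
Qed.

(** This permits the exchange of [lne] and [ln], which differ at 0: [lne] is -oo there and [ln] is
    0. *)
Lemma density_gt0_ae : {ae nu, forall x, (0 < g x)%R}.
Proof.
have mg0 : measurable [set x | (g x <= 0)%R].
  by rewrite -[X in measurable X]setTI; exact: measurable_fun_le.
exists [set x | (g x <= 0)%R]; split => //; last first.
  by move=> x /= /negP; rewrite -leNgt.
rewrite [LHS]nug// integral0_eq// => x /= gx.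
by congr EFin; apply/eqP; rewrite eq_le gx g0.
Qed.

Let lne_RN_ae : ae_eq nu setT
  (fun x => lne (('d (charge_of_finite_measure nu) '/d mu) x))
  (fun x => (ln (g x))%:E).
Proof.
have h1 : ae_eq nu setT F (EFin \o g) by exact: null_dominates_ae_eq F_ae_eq.
have h2 : ae_eq nu setT F ('d (charge_of_finite_measure nu) '/d mu).
  by apply: null_dominates_ae_eq numu _ => //; exact: ae_eq_Radon_Nikodym_SigmaFinite.
have h3 := density_gt0_ae.
apply: filterS3 h1 h2 h3 => x h1 h2 h3 _.
have <- : F x = ('d (charge_of_finite_measure nu) '/d mu) x by exact: h2.
by rewrite h1// lne_EFin.
Qed.

Let measurable_lne_RN : measurable_fun setT
  (fun x => lne (('d (charge_of_finite_measure nu) '/d mu) x)).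
Proof.
pose h x := fine (('d (charge_of_finite_measure nu) '/d mu) x).
have mh : measurable_fun setT h.
  by apply: measurableT_comp => //; apply: measurable_int;
    exact: Radon_Nikodym_integrable.
rewrite (_ : (fun _ => _) = (fun x => if (0 < h x)%R then (ln (h x))%:E else -oo)).
  apply: measurable_fun_ifT => //; first exact: measurable_fun_ltr.
  by apply/measurable_EFinP; exact: measurableT_comp.
apply/funext => x; rewrite -[X in lne X]fineK ?Radon_Nikodym_fin_num// -/(h x).
by case: ltP => hx; [rewrite lne_EFin|rewrite le0_lneNy].
Qed.

(** Adding 1 - g to g ln g leaves the integral unchanged, as g has integral 1, and makes the
    integrand nonnegative, so that later arguments never meet a difference of infinities. *)
Lemma integral_lne_RN :
  \int[nu]_x lne (('d (charge_of_finite_measure nu) '/d mu) x) =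
  \int[mu]_x (entf (g x))%:E.
Proof.
have mlng : measurable_fun setT (fun x => (ln (g x))%:E).
  by apply/measurable_EFinP; exact: measurableT_comp.
rewrite (ae_eq_integral (fun x => (ln (g x))%:E))//.
rewrite integralE.
rewrite !ge0_integral_density//; [|exact: measurable_funeneg|exact: measurable_funepos].
set P := (X in X - _); set N := (X in _ - X).
have mg' : measurable_fun setT (EFin \o g) by exact/measurable_EFinP.
have g1 : \int[mu]_x (g x)%:E = 1 by rewrite -nug//; exact: probability_setT.
have neg_ge0 x : 0 <= (fun x => (ln (g x))%:E)^\- x * (g x)%:E.
  by rewrite mule_ge0// lee_fin.
have pos_ge0 x : 0 <= (fun x => (ln (g x))%:E)^\+ x * (g x)%:E.
  by rewrite mule_ge0// lee_fin.
have mneg : measurable_fun setT (fun x => (fun x => (ln (g x))%:E)^\- x * (g x)%:E).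
  by apply: emeasurable_funM => //; exact: measurable_funeneg.
have mpos : measurable_fun setT (fun x => (fun x => (ln (g x))%:E)^\+ x * (g x)%:E).
  by apply: emeasurable_funM => //; exact: measurable_funepos.
have ment : measurable_fun setT (fun x => (entf (g x))%:E).
  apply/measurable_EFinP; apply: measurable_funD => //; apply: measurable_funB => //.
  by apply: measurable_funM => //; exact: measurableT_comp.
have ent_ge0 x : 0 <= (entf (g x))%:E by rewrite lee_fin entf_ge0.
have eqN : \int[mu]_x (entf (g x))%:E + N + 1 = P + 1.
  rewrite -{1}g1 /N -ge0_integralD//.
  rewrite -ge0_integralD//; last 3 first.
  - by move=> x _; rewrite adde_ge0.
  - exact: emeasurable_funD.
  - by move=> x _; rewrite lee_fin.
  have e1 : 1 = \int[mu]_x (cst 1 x) :> \bar R.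
    by rewrite integral_cst// mul1e; exact/esym/probability_setT.
  rewrite [X in _ = P + X]e1 /P -ge0_integralD//.
  apply: eq_integral => x _.
  rewrite funenegE funeposE -EFinN -!EFin_max -!EFinM -!EFinD; congr EFin.
  rewrite /entf /Num.max oppr_lt0; case: ltgtP => h; last by rewrite -h; ring.
  - by ring.
  - by ring.
(* Nonnegativity of [entf] gives -t ln t <= 1 - t <= 1, so only the positive part can have an
   infinite integral, and N can be cancelled. *)
have Nfin : N < +oo.
  rewrite (@le_lt_trans _ _ (\int[mu]_x (cst 1 x)))//; last first.
    by rewrite integral_cst// mul1e [X in X < _]probability_setT ltry.
  apply: ge0_le_integral => // x _ /=.
  rewrite funenegE -EFinN -EFin_max -EFinM lee_fin /Num.max.
  by case: ltP => h; have := entf_ge0 (g0 x); have := g0 x; rewrite /entf; lra.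
have N0 : 0 <= N by apply: integral_ge0.
have Nf : N \is a fin_num by rewrite ge0_fin_numE.
have -> : P = \int[mu]_x (entf (g x))%:E + N.
  by move/(congr1 (fun z => z - 1)) : eqN; rewrite !addeK.
by rewrite addeK.
Qed.

End change_of_density.

Lemma density_of_dominates d (T : measurableType d) (R : realType)
    (mu nu : probability T R) : nu `<< mu ->
  exists g : T -> R, [/\ forall x, (0 <= g x)%R, measurable_fun setT g &
    forall A, measurable A -> nu A = \int[mu]_(x in A) (g x)%:E].
Proof.
move=> numu; pose F := Radon_Nikodym_SigmaFinite.f nu mu.
have FE x : (fine (F x))%:E = F x.
  by rewrite fineK//; exact: Radon_Nikodym_SigmaFinite.f_fin_num.
exists (fine \o F); split => [x||A mA].
- by rewrite /= fine_ge0//; exact: Radon_Nikodym_SigmaFinite.f_ge0.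
- apply: measurableT_comp => //; apply: measurable_int.
  exact: Radon_Nikodym_SigmaFinite.f_integrable.
- rewrite (Radon_Nikodym_SigmaFinite.f_integral numu mA).
  by apply: eq_integral => x _; rewrite /= FE.
Qed.

Section integral_mixture.
Context dX dY (X : measurableType dX) (Y : measurableType dY) (R : realType).
Variables (alpha : probability X R) (k : X -> {measure set Y -> \bar R})
  (beta : {measure set Y -> \bar R}).
Hypotheses (k1 : forall x, k x setT = 1)
  (mk : forall B, measurable B -> measurable_fun setT (fun x => k x B))
  (betaE : forall B, measurable B -> beta B = \int[alpha]_x k x B).

(** A constant kernel from a point: beta is then the composition of alpha with k, and integration
    against composed kernels applies. This serves for mixtures as well as for disintegrations, where
    beta is the second marginal of a coupling. *)
Let l (_ : unit) : {measure set X -> \bar R} := alpha.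
Let k' (z : unit * X) : {measure set Y -> \bar R} := k z.2.

Let ml U : measurable U -> measurable_fun setT (l ^~ U).
Proof. by move=> mU; exact: measurable_cst. Qed.

HB.instance Definition _ := isKernel.Build _ _ _ _ _ l ml.
HB.instance Definition _ := Kernel_isProbability.Build _ _ _ _ _ l
  (fun=> @probability_setT _ _ _ alpha).

Let mk' U : measurable U -> measurable_fun setT (k' ^~ U).
Proof.
move=> mU; rewrite (_ : k' ^~ U = (fun x => k x U) \o snd)//.
by apply: measurableT_comp => //; exact: mk.
Qed.

HB.instance Definition _ := isKernel.Build _ _ _ _ _ k' mk'.
HB.instance Definition _ := Kernel_isProbability.Build _ _ _ _ _ k'
  (fun z => k1 z.2).

Lemma ge0_integral_mixture h : measurable_fun setT h -> (forall y, 0 <= h y) ->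
  \int[beta]_y h y = \int[alpha]_x \int[k x]_y h y.
Proof.
move=> mh h0; transitivity (\int[mkcomp l k' tt]_y h y).
  apply: eq_measure_integral => B mB _; exact: (betaE mB).
exact: integral_kcomp.
Qed.

Lemma measurable_integral_mixture h :
  measurable_fun setT h -> (forall y, 0 <= h y) ->
  measurable_fun setT (fun x => \int[k x]_y h y).
Proof. by move=> mh h0; exact: measurable_fun_integral_kernel. Qed.

End integral_mixture.

(** * Conjugates and weak transport *)

Section dot_product.
Context {R : realType} {d : nat}.
Implicit Types (u x y : 'rV[R]_d).
Local Open Scope ring_scope.

Definition dotp u x : R := \sum_(i < d) u 0 i * x 0 i.

Lemma dotpxx_ge0 u : 0 <= dotp u u.
Proof. by apply: sumr_ge0 => i _; rewrite -expr2 sqr_ge0. Qed.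

Lemma eucl_norm_sqr x : eucl_norm x ^+ 2 = dotp x x.
Proof.
rewrite sqr_sqrtr; last by apply: sumr_ge0 => i _; rewrite sqr_ge0.
by apply: eq_bigr => i _; rewrite expr2.
Qed.

Lemma eucl_norm_ge0 x : 0 <= eucl_norm x. Proof. exact: sqrtr_ge0. Qed.

Lemma coord_le_eucl_norm x i : `|x 0 i| <= eucl_norm x.
Proof.
rewrite -sqrtr_sqr ler_wsqrtr// (bigD1 i)//= lerDl sumr_ge0// => j _.
exact: sqr_ge0.
Qed.

Lemma eucl_norm_le_sqr x : eucl_norm x <= 1 + dotp x x.
Proof. by rewrite -eucl_norm_sqr; have := eucl_norm_ge0 x; nra. Qed.

Lemma dotp_le_sqr a (p : R) u x : 0 < a ->
  p * dotp u x <= a * dotp u u + p ^+ 2 / (4 * a) * dotp x x.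
Proof.
move=> a0; rewrite /dotp !mulr_sumr -big_split/=; apply: ler_sum => i _.
have : 0 <= (2 * a * u 0 i - p * x 0 i) ^+ 2 / (4 * a).
  by rewrite divr_ge0 ?sqr_ge0// mulr_ge0// ltW.
rewrite -subr_ge0; congr (0 <= _); field.
by rewrite gt_eqF.
Qed.

Lemma dotp0l x : dotp 0 x = 0.
Proof. by rewrite /dotp big1// => i _; rewrite mxE mul0r. Qed.

Lemma dotpDr u x y : dotp u (x + y) = dotp u x + dotp u y.
Proof. by rewrite /dotp -big_split; apply: eq_bigr => i _; rewrite mxE mulrDr. Qed.

Lemma dotpNr u x : dotp u (- x) = - dotp u x.
Proof. by rewrite /dotp -sumrN; apply: eq_bigr => i _; rewrite mxE mulrN. Qed.

End dot_product.

Section measurability_Rd.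
Context {R : realType} {d : nat}.
Implicit Types (u x y : 'rV[R]_d).

Lemma open_measurable_Rd (A : set (Rd R d)) :
  open (A : set 'rV[R]_d) -> measurable A.
Proof. by move=> oA; exact: sub_sigma_algebra. Qed.

Lemma measurable_coord (i : 'I_d) :
  measurable_fun setT (fun x : Rd R d => (x : 'rV[R]_d) 0%R i).
Proof.
apply: (measurability _ (RGenOpens.measurableE R)) => _ [_ [a [b ->] <-]].
rewrite setTI; apply: open_measurable_Rd.
apply: open_comp => [x _|]; first exact: coord_continuous.
exact: interval_open.
Qed.

Lemma measurable_dotp dT (T : measurableType dT) (f g : T -> 'rV[R]_d) :
  (forall i, measurable_fun setT (fun t => f t 0%R i)) ->
  (forall i, measurable_fun setT (fun t => g t 0%R i)) ->
  measurable_fun setT (fun t => dotp (f t) (g t)).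
Proof.
move=> mf mg; apply: measurable_sum => i; exact: measurable_funM.
Qed.

Lemma measurable_eucl_norm dT (T : measurableType dT) (f : T -> 'rV[R]_d) :
  (forall i, measurable_fun setT (fun t => f t 0%R i)) ->
  measurable_fun setT (fun t => eucl_norm (f t)).
Proof.
move=> mf; apply: measurableT_comp => //.
  by apply: continuous_measurable_fun; exact: sqrt_continuous.
apply: measurable_sum => i; exact: measurable_funX.
Qed.

End measurability_Rd.

Section barycenter.
Context {R : realType} {d : nat}.

Lemma dotp_barycenter (q : {measure set Rd R d -> \bar R}) (u : 'rV[R]_d) (c : R) :
  q setT = 1 ->
  (forall i, q.-integrable setT (fun y => ((y : 'rV[R]_d) 0%R i)%:E)) ->
  (dotp u (barycenter q) - c)%:E = \int[q]_y (dotp u y - c)%:E.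
Proof.
move=> q1 qi.
have qc : q.-integrable setT (cst c%:E).
  apply/integrableP; split; first exact: measurable_cst.
  by rewrite integral_cst// q1 mule1/= ltry.
have qu i : q.-integrable setT (fun y => (u 0%R i * (y : 'rV[R]_d) 0%R i)%:E).
  rewrite (_ : (fun _ => _) = (fun y => (u 0%R i)%:E * ((y : 'rV[R]_d) 0%R i)%:E)).
    exact: integrableZl.
  by apply/funext => y; rewrite EFinM.
under eq_integral do rewrite EFinB.
rewrite integralB//; last first.
  under eq_fun do rewrite /dotp -sumEFin.
  exact: integrable_sum.
rewrite integral_cst// q1 mule1 EFinB; congr (_ - _).
under [RHS]eq_integral do rewrite /dotp -sumEFin.
rewrite integral_sum// /dotp -sumEFin; apply: eq_bigr => i _.
rewrite mxE EFinM fineK; last exact: integrable_fin_num.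
by rewrite -integralZl//; apply: eq_integral => y _; rewrite EFinM.
Qed.

Lemma measurable_barycenter dX (X : measurableType dX)
    (k : X -> {measure set Rd R d -> \bar R}) :
  (forall B, measurable B -> measurable_fun setT (fun x => k x B)) ->
  forall i, measurable_fun setT (fun x => barycenter (k x) 0%R i).
Proof.
move=> mk i; rewrite (_ : (fun _ => _) =
    fun x => fine (\int[k x]_y ((y : 'rV[R]_d) 0%R i)%:E)); last first.
  by apply/funext => x; rewrite mxE.
have mi : measurable_fun setT (EFin \o (fun y : Rd R d => (y : 'rV[R]_d) 0%R i)).
  by apply/measurable_EFinP; exact: measurable_coord.
apply: measurableT_comp => //.
under eq_fun do rewrite integralE.
by apply: emeasurable_funB; apply: measurable_fun_integral_kernel => //;
  [exact: measurable_funepos|exact: measurable_funeneg].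
Qed.

End barycenter.

(** The integral of f, whatever its value, is at most that of its positive part, and f^+ <= h. *)
Lemma integral_le_ge0 d (T : measurableType d) (R : realType)
    (q : {measure set T -> \bar R}) (f h : T -> \bar R) :
  measurable_fun setT f -> measurable_fun setT h -> (forall x, 0 <= h x) ->
  (forall x, f x <= h x) -> \int[q]_x f x <= \int[q]_x h x.
Proof.
move=> mf mh h0 fh; rewrite integralE.
rewrite (@le_trans _ _ (\int[q]_x f^\+ x))//.
  by rewrite -[leRHS]adde0 leeD2l// leeNl oppe0 integral_ge0.
apply: ge0_le_integral => //; first exact: measurable_funepos.
by move=> x _; rewrite funeposE ge_max fh h0.
Qed.

Lemma dotp_continuous {R : realType} {d : nat} (u : 'rV[R]_d) :
  continuous (dotp u).
Proof.
rewrite /dotp; apply: continuous_big => [|i _ x]; first exact: add_continuous.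
exact: (@cvgMl_tmp _ _ _ (nbhs_filter x) _ _ _ (@coord_continuous R 1 d _ i x)).
Qed.

Section conjugate.
Context {R : realType} {d : nat}.
Variables (U : set 'rV[R]_d) (G : 'rV[R]_d -> R).
Implicit Types (u x y : 'rV[R]_d) (s a p : R).

(** Legendre-Fenchel conjugate of G + s |.|^2 on U. As a supremum of affine functions of x it obeys
    Jensen's inequality at barycenters, which is all that a weak cost sees. The set U is everything
    for the duality, and {0, u} when a single direction is tested. *)
Definition conjugate s x : \bar R :=
  ereal_sup [set (dotp u x - (G u + s * dotp u u))%:E | u in U].

Lemma conjugate_ge s x u : U u ->
  (dotp u x - (G u + s * dotp u u))%:E <= conjugate s x.
Proof. by move=> Uu; apply: ereal_sup_ubound; exists u. Qed.

Lemma conjugate_ge0 s x : U 0%R -> G 0%R = 0%R -> 0 <= conjugate s x.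
Proof.
move=> U0 G0; apply: le_trans (conjugate_ge s x U0).
by rewrite lee_fin !dotp0l G0 mulr0 addr0 subr0.
Qed.

(* A supremum of arbitrarily many affine functions is lower semicontinuous. *)
Lemma measurable_conjugate s :
  measurable_fun setT (conjugate s : Rd R d -> \bar R).
Proof.
apply: (measurability _ (ErealGenOInfty.measurableE R)) => _ [_ [a ->] <-].
rewrite setTI preimage_itvoy; apply: open_measurable_Rd.
rewrite (_ : [set _ | _] = \bigcup_(u in U)
    (fun x => dotp u x) @^-1` [set r | (a + (G u + s * dotp u u) < r)%R]).
  apply: bigcup_open => u Uu; apply: open_comp; last exact: open_gt.
  by move=> x _; exact: dotp_continuous.
apply/seteqP; split => x /=.
  move=> /ereal_sup_gt[_ [u Uu <-]]; rewrite lte_fin ltrBrDr => h.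
  by exists u.
move=> [u Uu]; rewrite /= -ltrBrDr => h.
by apply: lt_le_trans (conjugate_ge s x Uu); rewrite lte_fin.
Qed.

End conjugate.

Section transport_duality.
Context {R : realType} {d : nat}.
Variables (U : set 'rV[R]_d) (G : 'rV[R]_d -> R).
Hypotheses (U0 : U 0%R) (G0 : G 0%R = 0%R).
Local Notation conj := (conjugate U G).

Let conj_ge0 s x : 0 <= conj s x. Proof. exact: conjugate_ge0. Qed.

Let mconj s : measurable_fun setT (conj s : Rd R d -> \bar R).
Proof. exact: measurable_conjugate. Qed.

(** For fixed u, write <u, x> = (1 - p) <u, x> + p <u, z> + p <u, x - z> with z the barycenter of q.
    The first two terms, each with its share of [c], are bounded by [conj s], at x and under the
    integral; the last is absorbed by the extra a |u|^2 through Young's inequality, which leaves p^2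
    |x - z|^2 / (4a). *)
Lemma conjugate_barycenter_le (q : {measure set Rd R d -> \bar R}) s a p
    (x : 'rV[R]_d) : (0 < a)%R -> (0 <= p <= 1)%R -> q setT = 1 ->
  (forall i, q.-integrable setT (fun y => ((y : 'rV[R]_d) 0%R i)%:E)) ->
  conj (s + a) x <= (1 - p)%:E * conj s x + p%:E * \int[q]_y conj s y +
    (p ^+ 2 / (2 * a))%:E * (2^-1 * eucl_norm (x - barycenter q) ^+ 2)%:E.
Proof.
move=> a0 /andP[p0 p1] q1 qi; apply: ge_ereal_sup => _ [u Uu <-].
set c := (G u + s * dotp u u)%R.
have -> : ((dotp u x - (G u + (s + a) * dotp u u)) =
    (1 - p) * (dotp u x - c) + p * (dotp u (barycenter q) - c) +
    (p * dotp u (x - barycenter q) - a * dotp u u))%R.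
  by rewrite /c dotpDr dotpNr; ring.
rewrite !EFinD; apply: leeD; first apply: leeD.
- by rewrite EFinM lee_wpmul2l ?lee_fin ?subr_ge0// conjugate_ge.
- rewrite EFinM lee_wpmul2l ?lee_fin// dotp_barycenter//.
  apply: integral_le_ge0 => //.
  + apply/measurable_EFinP; apply: measurable_funB => //.
    by apply: measurable_dotp => // i; exact: measurable_coord.
  + by move=> y; exact: conjugate_ge.
- rewrite -EFinM lee_fin lerBlDl eucl_norm_sqr.
  apply: le_trans (dotp_le_sqr _ _ _ a0) _.
  by rewrite lerD2l le_eqVlt; apply/orP; left; apply/eqP; field; rewrite gt_eqF.
Qed.

(** A point stays with probability 1 - p and follows a nearly optimal coupling with probability p;
    the pointwise bound is integrated along the disintegration of that coupling, which sends alpha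
    to beta. *)
Lemma integral_conjugate_le (alpha beta : probability (Rd R d) R) s a p D :
  (0 < a)%R -> (0 <= p <= 1)%R -> P1 beta ->
  weak_cost beta alpha <= D%:E ->
  \int[alpha]_x conj (s + a) x <= (1 - p)%:E * \int[alpha]_x conj s x +
    p%:E * \int[beta]_x conj s x + (p ^+ 2 / (2 * a) * D)%:E.
Proof.
move=> a0 p01 P1b costD.
have k0 : (0 <= p ^+ 2 / (2 * a))%R by rewrite divr_ge0 ?sqr_ge0 ?mulr_ge0// ltW.
move: (p01) => /andP[p0 p1].
suff H c : (exists pi k, [/\ coupling alpha beta pi, disintegration alpha pi k &
      c = \int[alpha]_x
        (2^-1 * eucl_norm ((x : 'rV[R]_d) - barycenter (k x)) ^+ 2)%:E]) ->
    \int[alpha]_x conj (s + a) x <= (1 - p)%:E * \int[alpha]_x conj s x +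
    p%:E * \int[beta]_x conj s x + (p ^+ 2 / (2 * a))%:E * c.
  apply/lee_addgt0Pr => e e0.
  (* The infimum need not be attained, hence the slack; the added 1 keeps the denominator positive
     when p = 0. *)
  have : weak_cost beta alpha < (D + e / (p ^+ 2 / (2 * a) + 1))%:E.
    rewrite (le_lt_trans costD)// lte_fin ltrDl divr_gt0//.
    by rewrite ltr_wpDl.
  move=> /ereal_inf_lt[c /H Hc cD].
  apply: (le_trans Hc); rewrite -[leRHS]addeA; apply: leeD2l.
  apply: (@le_trans _ _ ((p ^+ 2 / (2 * a))%:E *
      (D + e / (p ^+ 2 / (2 * a) + 1))%:E)).
    by rewrite lee_wpmul2l ?lee_fin// ltW.
  rewrite -EFinM -EFinD lee_fin mulrDr lerD2l mulrCA ler_piMr ?(ltW e0)//.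
  by rewrite ler_pdivrMr ?mul1r ?lerDl// ltr_wpDl.
move=> [pi [k [[pi1 pi2] pik ->]]].
have mk B : measurable B -> measurable_fun setT (fun x => k x B).
  exact: measurable_kernel.
have k1 x : k x setT = 1 by exact: prob_kernel.
have betaE B : measurable B -> beta B = \int[alpha]_x k x B.
  by move=> mB; rewrite -pi2// pik.
have mE : measurable_fun setT (fun y : Rd R d => (eucl_norm y)%:E).
  by apply/measurable_EFinP; apply: measurable_eucl_norm => i; exact: measurable_coord.
have E0 (y : Rd R d) : 0 <= (eucl_norm y)%:E by rewrite lee_fin eucl_norm_ge0.
have mcost : measurable_fun setT (fun x : Rd R d =>
    (2^-1 * eucl_norm ((x : 'rV[R]_d) - barycenter (k x)) ^+ 2)%:E).
  apply/measurable_EFinP; apply: measurable_funM => //; apply: measurable_funX.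
  apply: measurable_eucl_norm => i; under eq_fun do rewrite mxE [X in (_ + X)%R]mxE.
  by apply: measurable_funB; [exact: measurable_coord|exact: measurable_barycenter].
have mik : measurable_fun setT (fun x => \int[k x]_y conj s y).
  exact: measurable_integral_mixture.
have cost0 (x : Rd R d) :
    0 <= (2^-1 * eucl_norm ((x : 'rV[R]_d) - barycenter (k x)) ^+ 2)%:E.
  by rewrite lee_fin mulr_ge0// sqr_ge0.
have ik0 x : 0 <= \int[k x]_y conj s y by exact: integral_ge0.
have p'0 : (0 <= 1 - p)%R by rewrite subr_ge0.
rewrite (ge0_integral_mixture k1 mk betaE)//.
rewrite -!ge0_integralZl_EFin//.
have m1 : measurable_fun setT (fun x : Rd R d => (1 - p)%:E * conj s x).
  exact: measurable_funeM.
have m2 : measurable_fun setT (fun x => p%:E * \int[k x]_y conj s y).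
  exact: measurable_funeM.
have m3 : measurable_fun setT (fun x : Rd R d => (p ^+ 2 / (2 * a))%:E *
    (2^-1 * eucl_norm ((x : 'rV[R]_d) - barycenter (k x)) ^+ 2)%:E).
  exact: measurable_funeM.
have p1' x : 0 <= (1 - p)%:E * conj s x by rewrite mule_ge0 ?lee_fin.
have p2' x : 0 <= p%:E * \int[k x]_y conj s y by rewrite mule_ge0 ?lee_fin.
have p3' x : 0 <= (p ^+ 2 / (2 * a))%:E *
    (2^-1 * eucl_norm ((x : 'rV[R]_d) - barycenter (k x)) ^+ 2)%:E.
  by apply: mule_ge0 => //; rewrite lee_fin.
rewrite -ge0_integralD//.
rewrite -ge0_integralD//; last 2 first.
- by move=> x _; rewrite adde_ge0.
- exact: emeasurable_funD.
apply: ae_ge0_le_integral => //.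
- by move=> x _; rewrite !adde_ge0.
- by apply: emeasurable_funD => //; exact: emeasurable_funD.
(* The first moment of beta is the alpha-average of those of the [k x], so almost every [k x] has a
   genuine barycenter. *)
have intE : alpha.-integrable setT (fun x => \int[k x]_y (eucl_norm y)%:E).
  apply/integrableP; split; first exact: measurable_integral_mixture.
  under eq_integral do rewrite gee0_abs ?integral_ge0//.
  by rewrite -(ge0_integral_mixture k1 mk betaE).
have := integrable_ae measurableT intE.
apply: filterS => x /(_ I) fx _.
apply: conjugate_barycenter_le => // i.
apply: (@le_integrable _ _ _ (k x) setT measurableT
  (fun y : Rd R d => ((y : 'rV[R]_d) 0%R i)%:E)
  (fun y : Rd R d => (eucl_norm y)%:E)) => //.
- by apply/measurable_EFinP; exact: measurable_coord.
- move=> y _ /=; rewrite lee_fin (ger0_norm (eucl_norm_ge0 _)).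
  exact: coord_le_eucl_norm.
- apply/integrableP; split => //.
  under eq_integral do rewrite gee0_abs//.
  by rewrite -ge0_fin_numE// integral_ge0.
Qed.

End transport_duality.

(** * The dual inequality for mixtures *)

Section two_stage.
Context {R : realType} {d : nat}.
Implicit Types (alpha beta nu : probability (Rd R d) R).
Variables (U : set 'rV[R]_d) (G : 'rV[R]_d -> R).
Hypotheses (U0 : U 0%R) (G0 : G 0%R = 0%R).
Local Notation conj := (conjugate U G).

Let conj_ge0 s x : 0 <= conj s x. Proof. exact: conjugate_ge0. Qed.

Let mconj s : measurable_fun setT (conj s : Rd R d -> \bar R).
Proof. exact: measurable_conjugate. Qed.

Lemma rel_entropy_density nu beta (g : Rd R d -> R) :
  (forall x, (0 <= g x)%R) -> measurable_fun setT g ->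
  (forall A, measurable A -> nu A = \int[beta]_(x in A) (g x)%:E) ->
  rel_entropy nu beta = \int[beta]_x (entf (g x))%:E.
Proof.
move=> g0 mg nug; rewrite /rel_entropy asboolT; last exact: dominates_of_density nug.
exact: integral_lne_RN.
Qed.

Lemma measurable_entf dT (T : measurableType dT) (f : T -> R) :
  measurable_fun setT f -> measurable_fun setT (fun x => entf (f x)).
Proof.
move=> mf; apply: measurable_funD => //; apply: measurable_funB => //.
by apply: measurable_funM => //; exact: measurableT_comp.
Qed.

Section two_stage_transport.
Variables (alpha beta : probability (Rd R d) R) (K : R).
Hypotheses (K0 : (0 < K)%R) (P1a : P1 alpha) (P1b : P1 beta).
Hypothesis T2a : forall nu, P1 nu ->
  weak_cost alpha nu <= (K / 2)%:E * rel_entropy nu alpha.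
Hypothesis T2ba : weak_cost beta alpha <= (K / 4)%:E.
Variable f : Rd R d -> R.
Hypotheses (f0 : forall x, (0 <= f x)%R) (mf : measurable_fun setT f).
Hypothesis f1 : \int[alpha]_x ((eucl_norm x)%:E * (f x)%:E) < +oo.

Let mfE : measurable_fun setT (EFin \o f). Proof. exact/measurable_EFinP. Qed.

(** [entf_scale] integrates to the chain rule because f has mass w: the entropy of the normalized
    density, weighted by w, is the entropy of f less that of its mass. *)
Lemma integral_entf_div (w : R) : (0 < w)%R ->
  \int[alpha]_x (f x)%:E = w%:E ->
  \int[alpha]_x (entf (f x))%:E < +oo ->
  \int[alpha]_x (entf (f x / w))%:E =
    (w^-1)%:E * (\int[alpha]_x (entf (f x))%:E - (entf w)%:E).
Proof.
move=> w0 fw ent_fin.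
have ie : alpha.-integrable setT (fun x => (entf (f x))%:E).
  apply/integrableP; split; first by apply/measurable_EFinP; exact: measurable_entf.
  by under eq_integral do rewrite gee0_abs ?lee_fin ?entf_ge0//.
have if_ : alpha.-integrable setT (EFin \o f).
  apply/integrableP; split => //.
  by under eq_integral do rewrite gee0_abs ?lee_fin//; rewrite fw ltry.
have ic : alpha.-integrable setT (cst (w - 1)%:E).
  apply/integrableP; split; first exact: measurable_cst.
  by rewrite integral_cst//= [X in _ * X]probability_setT mule1 ltry.
have il : alpha.-integrable setT (fun x => (ln w)%:E * (f x)%:E).
  exact: integrableZl.
have il' : alpha.-integrable setT (fun x => (ln w)%:E * (f x)%:E - (w - 1)%:E).
  exact: integrableB.
rewrite (_ : (entf w)%:E = \int[alpha]_x ((ln w)%:E * (f x)%:E - (w - 1)%:E)); last first.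
  rewrite integralB// integralZl// fw integral_cst// [X in _ - _ * X]probability_setT.
  by rewrite mule1 -EFinM -EFinB /entf; congr EFin; ring.
rewrite -integralB// -integralZl//; last exact: integrableB.
apply: eq_integral => x _.
transitivity (w^-1 * (entf (f x) - (ln w * f x - (w - 1))))%:E => //.
by congr EFin; rewrite (entf_scale (f0 x) w0); field; rewrite gt_eqF.
Qed.

(** Here alpha is mu_t, beta is mu_t' and f is the density of nu, of mass w under alpha. The
    estimate is multiplied by w so as to make sense at w = 0; then w (1 - p) and w p become min(w,
    1) and (w - 1)_+. The term [entf w] subtracted in the chain rule is what pays for the second
    stage, so the two costs add up to the entropy of f. *)
Lemma two_stage_transport (a w : R) : (0 < a)%R ->
  \int[alpha]_x (f x)%:E = w%:E ->
  \int[alpha]_x (conj a x * (f x)%:E) <=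
    (Num.min w 1)%:E * \int[alpha]_x conj 0 x +
    (Num.max (w - 1) 0)%:E * \int[beta]_x conj 0 x +
    (K / (2 * a))%:E * \int[alpha]_x (entf (f x))%:E.
Proof.
move=> a0 fw.
have w0 : (0 <= w)%R by rewrite -lee_fin -fw integral_ge0// => x _; rewrite lee_fin.
have ent0 : 0 <= \int[alpha]_x (entf (f x))%:E.
  by apply: integral_ge0 => x _; rewrite lee_fin entf_ge0.
have conj_int0 (q : {measure set Rd R d -> \bar R}) s : 0 <= \int[q]_x conj s x.
  exact: integral_ge0.
have min0 : (0 <= Num.min w 1)%R by rewrite le_min w0 ler01.
have max0 : (0 <= Num.max (w - 1) 0)%R by rewrite le_max lexx orbT.
have Ka0 : (0 < K / (2 * a))%R by rewrite divr_gt0// mulr_gt0.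
move: w0; rewrite le_eqVlt => /predU1P[w_eq0|w0].
  rewrite (_ : \int[alpha]_x (conj a x * (f x)%:E) = 0).
    by rewrite !adde_ge0 ?mule_ge0 ?lee_fin// ltW.
  have : ae_eq alpha setT (EFin \o f) (cst 0).
    apply/ae_eq_integral_abs => //.
    by under eq_integral do rewrite gee0_abs ?lee_fin//; rewrite fw -w_eq0.
  move=> fae; rewrite -[RHS](@integral0 _ _ _ alpha setT).
  apply: ae_eq_integral => //; first exact: emeasurable_funM.
  by apply: filterS fae => x /(_ I) /= -> _; rewrite mule0.
have [ent_oo|ent_fin] := leP +oo (\int[alpha]_x (entf (f x))%:E).
  move: ent_oo; rewrite leye_eq => /eqP ->.
  by rewrite gt0_muley ?lte_fin// addey ?leey// -ltNye (lt_le_trans ltNy0)//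
    adde_ge0// mule_ge0// lee_fin.
pose E := fine (\int[alpha]_x (entf (f x))%:E).
have EE : \int[alpha]_x (entf (f x))%:E = E%:E by rewrite fineK// ge0_fin_numE.
have fwE := integral_entf_div w0 fw ent_fin.
rewrite EE in fwE *.
have g0 x : (0 <= f x / w)%R by rewrite divr_ge0// ltW.
have mg : measurable_fun setT (fun x => f x / w)%R by exact: measurable_funM.
have g1 : \int[alpha]_x (f x / w)%:E = 1.
  under eq_integral do rewrite mulrC EFinM.
  rewrite ge0_integralZl_EFin ?invr_ge0 ?(ltW w0)//; last by move=> x _; rewrite lee_fin.
  by rewrite fw -EFinM mulVf// gt_eqF.
pose nu : probability (Rd R d) R := density g0 mg g1.
have nuE A : measurable A -> nu A = \int[alpha]_(x in A) (f x / w)%:E by [].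
have int_nu h : measurable_fun setT h -> (forall x, 0 <= h x) ->
    \int[nu]_x h x = (w^-1)%:E * \int[alpha]_x (h x * (f x)%:E).
  move=> mh h0; rewrite (ge0_integral_density mg nuE)//.
  rewrite -ge0_integralZl_EFin ?invr_ge0 ?(ltW w0)//.
  - by apply: eq_integral => x _; rewrite EFinM muleA muleC.
  - by move=> x _; rewrite mule_ge0 ?lee_fin.
  - exact: emeasurable_funM.
have P1nu : P1 nu.
  rewrite /P1 int_nu//; first by rewrite lte_mul_pinfty// lee_fin invr_ge0 ltW.
    apply/measurable_EFinP; apply: measurable_eucl_norm => i; exact: measurable_coord.
  by move=> x; rewrite lee_fin eucl_norm_ge0.
have cost1 : weak_cost alpha nu <= (K / 2 * (w^-1 * (E - entf w)))%:E.
  apply: le_trans (T2a P1nu) _.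
  by rewrite (rel_entropy_density g0 mg nuE) fwE -EFinB -!EFinM.
have a20 : (0 < a / 2)%R by rewrite divr_gt0.
have := integral_conjugate_le U0 G0 (a / 2)%R a20 (p := 1%R) _ P1a cost1.
rewrite lexx ler01 -splitr subrr mul0e add0e mul1e => /(_ isT) stage1.
(* The mass of f in excess of 1, as a proportion of w; for w <= 1 nothing moves. *)
pose p := (Num.max (w - 1) 0 / w)%R.
have p01 : (0 <= p <= 1)%R.
  rewrite divr_ge0 ?(ltW w0)//= ler_pdivrMr// mul1r ge_max (ltW w0) andbT.
  by rewrite lerBlDr lerDl.
have := integral_conjugate_le U0 G0 0%R a20 p01 P1b T2ba.
rewrite add0r => stage2.
have -> : \int[alpha]_x (conj a x * (f x)%:E) = w%:E * \int[nu]_x conj a x.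
  by rewrite int_nu// muleA -EFinM divff ?mul1e// gt_eqF.
have wp : (w * p = Num.max (w - 1) 0)%R by rewrite /p mulrC divfK// gt_eqF.
have w1p : (w * (1 - p) = Num.min w 1)%R.
  rewrite mulrBr mulr1 wp; case: (leP w 1%R) => w1.
    by rewrite (elimT max_idPr) ?subr0// subr_le0.
  by rewrite (elimT max_idPl) ?subr_ge0 ?(ltW w1)//; ring.
have wpp : (w * p ^+ 2 <= 2 * entf w)%R.
  rewrite expr2 mulrA wp /p; case: (leP 1%R w) => w1; last first.
    by rewrite (elimT max_idPr) ?mul0r ?mulr_ge0 ?entf_ge0 ?(ltW w0)// subr_le0 ltW.
  rewrite (elimT max_idPl) ?subr_ge0// mulrA ler_pdivrMr// -expr2.
  by rewrite (le_trans (entf_ge_marton w1))// mulrAC.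
apply: (@le_trans _ _ (w%:E * ((1 - p)%:E * \int[alpha]_x conj 0 x +
    p%:E * \int[beta]_x conj 0 x + (p ^+ 2 / (2 * (a / 2)) * (K / 4))%:E +
    (1 ^+ 2 / (2 * (a / 2)) * (K / 2 * (w^-1 * (E - entf w))))%:E))).
  rewrite lee_wpmul2l ?lee_fin ?(ltW w0)//.
  by apply: (le_trans stage1); rewrite leeD2r.
move: p01 => /andP[p0 p1].
rewrite -addeA -EFinD muleDr ?fin_num_adde_defl//.
rewrite ge0_muleDr ?mule_ge0 ?lee_fin ?subr_ge0// !muleA -!EFinM wp w1p.
rewrite leeD2l// lee_fin.
have -> : (w * (p ^+ 2 / (2 * (a / 2)) * (K / 4) +
    1 ^+ 2 / (2 * (a / 2)) * (K / 2 * (w^-1 * (E - entf w)))) =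
    K / (2 * a) * ((w * p ^+ 2) / 2 + (E - entf w)))%R.
  by field; rewrite !gt_eqF.
rewrite ler_pM2l//; move: wpp; lra.
Qed.

End two_stage_transport.

End two_stage.

(** It replaces the target of the second stage by the infimum over all targets, so that no target
    has to be chosen as a function of t. One cannot subtract and divide when q = 0 or A = +oo; the
    first of these cases is why an index must exist. *)
Lemma leeD_mul_ereal_inf (R : realType) (I : Type) (X A : \bar R) (q : R) (B : I -> \bar R) :
  (0 <= q)%R -> 0 <= A -> (forall i, 0 <= B i) -> (exists i : I, True) ->
  (forall i, X <= A + q%:E * B i) ->
  X <= A + q%:E * ereal_inf (range B).
Proof.
move=> q0 A0 B0 [i0 _] XAB; move: q0; rewrite le_eqVlt => /predU1P[q0|q0].
  by have := XAB i0; rewrite -q0 !mul0e.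
have [->|] := eqVneq A +oo.
  rewrite addye ?leey// -ltNye (lt_le_trans ltNy0)// mule_ge0//.
    by rewrite lee_fin ltW.
  by apply/ereal_infP => _ [i _ <-].
rewrite -ltey => Aoo; have Af : A \is a fin_num by rewrite ge0_fin_numE.
rewrite -leeBlDl// -lee_pdivrMl//; apply/ereal_infP => _ [i _ <-].
by rewrite lee_pdivrMl// leeBlDl.
Qed.

Section mixture_duality.
Context {R : realType} {d : nat} {dT : measure_display}.
Variables (Theta : measurableType dT) (m : probability Theta R)
  (mu : Theta -> probability (Rd R d) R) (hmu : measurable_family mu).
Variables (U : set 'rV[R]_d) (G : 'rV[R]_d -> R).
Hypotheses (U0 : U 0%R) (G0 : G 0%R = 0%R).
Local Notation conj := (conjugate U G).
Variable K : R.
Hypotheses (K0 : (0 < K)%R) (P1mu : forall t, P1 (mu t)).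
Hypothesis T2mu : forall t nu, P1 nu ->
  weak_cost (mu t) nu <= (K / 2)%:E * rel_entropy nu (mu t).
Hypothesis costmu : forall t t', weak_cost (mu t) (mu t') <= (K / 4)%:E.

Lemma ge0_integral_mix h : measurable_fun setT h -> (forall x, 0 <= h x) ->
  \int[mixture m hmu]_x h x = \int[m]_t \int[mu t]_x h x.
Proof.
move=> mh h0; apply: ge0_integral_mixture => //.
by move=> t; exact: probability_setT.
Qed.

Lemma measurable_integral_mu h : measurable_fun setT h -> (forall x, 0 <= h x) ->
  measurable_fun setT (fun t => \int[mu t]_x h x).
Proof. by move=> mh h0; exact: measurable_integral_mixture. Qed.

(** The excess (w - 1)_+ at t is charged the infimum [I0] of h. Since w has mean 1, its total equals
    that of the deficit (1 - w)_+, and at a point of deficit [I0] is at most [h t]; with min(w, 1) +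
    (1 - w)_+ = 1 this rebuilds int h dm, the integral over the mixture. Only the masses of Marton's
    coupling enter. *)
Lemma mixture_weak_duality nu a : (0 < a)%R -> P1 nu ->
  nu `<< mixture m hmu ->
  \int[nu]_x conj a x <= \int[mixture m hmu]_x conj 0 x +
    (K / (2 * a))%:E * rel_entropy nu (mixture m hmu).
Proof.
move=> a0 P1nu /density_of_dominates[f [f0 mf nuf]].
rewrite (rel_entropy_density f0 mf nuf).
have conj_ge0 s x : 0 <= conj s x by exact: conjugate_ge0.
have mconj s : measurable_fun setT (conj s : Rd R d -> \bar R).
  exact: measurable_conjugate.
have mfE : measurable_fun setT (EFin \o f) by exact/measurable_EFinP.
have fE0 x : 0 <= (EFin \o f) x by rewrite lee_fin.
have meucl : measurable_fun setT (fun x : Rd R d => (eucl_norm x)%:E).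
  by apply/measurable_EFinP; apply: measurable_eucl_norm => i; exact: measurable_coord.
have eucl0 (x : Rd R d) : 0 <= (eucl_norm x)%:E by rewrite lee_fin eucl_norm_ge0.
pose W t := \int[mu t]_x (f x)%:E.
have W0 t : 0 <= W t by apply: integral_ge0 => x _; rewrite lee_fin.
have mW : measurable_fun setT W by exact: measurable_integral_mu.
have intW : \int[m]_t W t = 1.
  by rewrite -ge0_integral_mix// -nuf//; exact: probability_setT.
pose w t := fine (W t).
have w0 t : (0 <= w t)%R by rewrite fine_ge0.
have mw : measurable_fun setT w by exact: measurableT_comp.
(* As W has integral 1, the convention that [fine] sends +oo to 0 matters on a null set only. *)
have W_ae : {ae m, forall t, W t = (w t)%:E}.
  have iW : m.-integrable setT W.
    apply/integrableP; split => //.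
    by under eq_integral do rewrite gee0_abs//; rewrite intW ltry.
  by apply: filterS (integrable_ae measurableT iW) => t /(_ I) Wt; rewrite /w fineK.
have intw : \int[m]_t (w t)%:E = 1.
  rewrite -intW; apply: ae_eq_integral => //; first exact/measurable_EFinP.
  by apply: filterS W_ae => t ->.
pose V t := \int[mu t]_x ((eucl_norm x)%:E * (f x)%:E).
have V_ae : {ae m, forall t, V t < +oo}.
  have V0 t : 0 <= V t by apply: integral_ge0 => x _; rewrite mule_ge0// lee_fin.
  have mef : measurable_fun setT (fun x : Rd R d => (eucl_norm x)%:E * (f x)%:E).
    exact: emeasurable_funM.
  have ef0 (x : Rd R d) : 0 <= (eucl_norm x)%:E * (f x)%:E.
    by rewrite mule_ge0// lee_fin.
  have mV : measurable_fun setT V by exact: measurable_integral_mu.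
  have iV : m.-integrable setT V.
    apply/integrableP; split => //.
    under eq_integral do rewrite gee0_abs//.
    by rewrite -ge0_integral_mix// -(ge0_integral_density mf nuf).
  by apply: filterS (integrable_ae measurableT iV) => t /(_ I); rewrite ge0_fin_numE.
pose h t := \int[mu t]_x conj 0 x.
have h0 t : 0 <= h t by exact: integral_ge0.
have mh : measurable_fun setT h by exact: measurable_integral_mu.
pose E t := \int[mu t]_x (entf (f x))%:E.
have ment : measurable_fun setT (fun x => (entf (f x))%:E).
  by apply/measurable_EFinP; exact: measurable_entf.
have ent0 x : 0 <= (entf (f x))%:E by rewrite lee_fin entf_ge0.
have E0 t : 0 <= E t by exact: integral_ge0.
have mE : measurable_fun setT E by exact: measurable_integral_mu.
pose I0 := ereal_inf (range h).
have I0_ge0 : 0 <= I0 by apply/ereal_infP => _ [t _ <-].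
have Theta_pt : exists t : Theta, True.
  apply: contrapT => noT; have := @probability_setT _ _ _ m.
  rewrite (_ : setT = set0) ?measure0; last first.
    by apply/seteqP; split => // t _; apply: noT; exists t.
  by move=> /eqP; rewrite eq_sym onee_eq0.
have Ka0 : (0 <= K / (2 * a))%R by rewrite divr_ge0 ?ltW// mulr_gt0.
have pointwise : {ae m, forall t, \int[mu t]_x (conj a x * (f x)%:E) <=
    (Num.min (w t) 1)%:E * h t + (K / (2 * a))%:E * E t +
    (Num.max (w t - 1) 0)%:E * I0}.
  apply: filterS2 W_ae V_ae => t Wt Vt.
  apply: leeD_mul_ereal_inf => // [||t'].
  - by rewrite le_max lexx orbT.
  - by rewrite adde_ge0 ?mule_ge0 ?lee_fin ?le_min ?w0 ?ler01.
  - rewrite addeAC; apply: two_stage_transport => //.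
    exact: T2mu.
have mmin : measurable_fun setT (fun t => Num.min (w t) 1)%R.
  exact: measurable_minr.
have mmax1 : measurable_fun setT (fun t => Num.max (w t - 1) 0)%R.
  by apply: measurable_maxr => //; exact: measurable_funB.
have mmax2 : measurable_fun setT (fun t => Num.max (1 - w t) 0)%R.
  by apply: measurable_maxr => //; exact: measurable_funB.
(* Integrate (w - 1)_+ + 1 = (1 - w)_+ + w, where w has integral 1, and cancel the finite 1. *)
have excess : \int[m]_t (Num.max (w t - 1) 0)%:E = \int[m]_t (Num.max (1 - w t) 0)%:E.
  have max_ge0 (r : R) : 0 <= (Num.max r 0)%:E by rewrite lee_fin le_max lexx orbT.
  have : \int[m]_t (Num.max (w t - 1) 0)%:E + 1 = \int[m]_t (Num.max (1 - w t) 0)%:E + 1.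
    rewrite -{2}intw.
    have {1}-> : 1 = \int[m]_t (cst 1 t) :> \bar R.
      by rewrite integral_cst// mul1e; exact/esym/probability_setT.
    rewrite -!ge0_integralD//.
    - apply: eq_integral => t _; rewrite /cst -!EFinD; congr EFin.
      by rewrite /Num.max subr_lt0 [(1 - _ < 0)%R]subr_lt0; case: ltgtP; lra.
    - exact/measurable_EFinP.
    - by move=> t _; rewrite lee_fin.
    - exact/measurable_EFinP.
    - exact/measurable_EFinP.
  by move=> /(congr1 (fun z => z - 1)); rewrite !addeK.
have min0 t : (0 <= Num.min (w t) 1)%R by rewrite le_min w0 ler01.
have max0 (r : R) : (0 <= Num.max r 0)%R by rewrite le_max lexx orbT.
have mminE : measurable_fun setT (fun t => (Num.min (w t) 1)%:E * h t).
  by apply: emeasurable_funM => //; exact/measurable_EFinP.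
have mEE : measurable_fun setT (fun t => (K / (2 * a))%:E * E t).
  exact: measurable_funeM.
have mI1 : measurable_fun setT (fun t => (Num.max (w t - 1) 0)%:E * I0).
  by apply: emeasurable_funM => //; exact/measurable_EFinP.
have mh2 : measurable_fun setT (fun t => (Num.max (1 - w t) 0)%:E * h t).
  by apply: emeasurable_funM => //; exact/measurable_EFinP.
have n1 t : 0 <= (Num.min (w t) 1)%:E * h t by rewrite mule_ge0 ?lee_fin.
have n2 t : 0 <= (K / (2 * a))%:E * E t by rewrite mule_ge0 ?lee_fin.
have n3 t : 0 <= (Num.max (w t - 1) 0)%:E * I0 by rewrite mule_ge0 ?lee_fin.
have n4 t : 0 <= (Num.max (1 - w t) 0)%:E * h t by rewrite mule_ge0 ?lee_fin.
rewrite (ge0_integral_density mf nuf)//.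
have mcf : measurable_fun setT (fun x : Rd R d => conj a x * (f x)%:E).
  exact: emeasurable_funM.
have cf0 (x : Rd R d) : 0 <= conj a x * (f x)%:E by rewrite mule_ge0 ?lee_fin.
rewrite !ge0_integral_mix//.
apply: (@le_trans _ _ (\int[m]_t ((Num.min (w t) 1)%:E * h t + (K / (2 * a))%:E * E t +
    (Num.max (w t - 1) 0)%:E * I0))).
  apply: ae_ge0_le_integral => //.
  - by move=> t _; exact: integral_ge0.
  - exact: measurable_integral_mu.
  - by move=> t _; rewrite !adde_ge0.
  - by apply: emeasurable_funD => //; exact: emeasurable_funD.
  - by apply: filterS pointwise => t + _.
rewrite ge0_integralD//; last 2 first.
- by move=> t _; rewrite adde_ge0.
- exact: emeasurable_funD.
rewrite ge0_integralD// ge0_integralZl_EFin// addeAC leeD2r//.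
rewrite ge0_integralZr//; last 2 first.
- exact/measurable_EFinP.
- by move=> t _; rewrite lee_fin.
rewrite excess -ge0_integralZr//; last 2 first.
- exact/measurable_EFinP.
- by move=> t _; rewrite lee_fin.
apply: (@le_trans _ _ (\int[m]_t ((Num.min (w t) 1)%:E * h t) +
    \int[m]_t ((Num.max (1 - w t) 0)%:E * h t))).
  rewrite leeD2l//; apply: ge0_le_integral => //.
  - by move=> t _; rewrite mule_ge0 ?lee_fin.
  - by apply: emeasurable_funM => //; exact/measurable_EFinP.
  - move=> t _; rewrite lee_wpmul2l ?lee_fin//.
    by apply: ereal_inf_lbound; exists t.
rewrite -ge0_integralD//; apply: ge0_le_integral => //.
- by move=> t _; rewrite adde_ge0.
- exact: emeasurable_funD.
- move=> t _; rewrite -ge0_muleDl ?lee_fin//.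
  rewrite -EFinD (_ : (Num.min (w t) 1 + Num.max (1 - w t) 0)%R = 1%R) ?mul1e//.
  rewrite /Num.min /Num.max; case: (ltgtP (w t) 1%R) => ?;
    case: ltP => ?; lra.
Qed.

End mixture_duality.

(** * Moments *)

Section second_moment.
Context {R : realType} {d : nat}.
Implicit Types (alpha beta nu : probability (Rd R d) R).

Definition posdot (u x : 'rV[R]_d) : R := Num.max (dotp u x) 0%R.

Lemma posdot_ge0 u x : (0 <= posdot u x)%R.
Proof. by rewrite le_max lexx orbT. Qed.

Lemma measurable_posdot u : measurable_fun setT (posdot u : Rd R d -> R).
Proof.
apply: measurable_maxr => //; apply: measurable_dotp => // i.
exact: measurable_coord.
Qed.

(** For a unit vector u, G = 0 and this set, the conjugate is <u, x>_+ at s = 0 and (<u, x> - a)_+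
    at s = a, so that transport duality compares one-directional moments. *)
Let zero_or u : set 'rV[R]_d := [set v | v = 0%R \/ v = u].

Let conj_le u x : dotp u u = 1%R ->
  conjugate (zero_or u) (cst 0%R) 0 x <= (posdot u x)%:E.
Proof.
move=> u1; apply: ge_ereal_sup => _ [v [->|->] <-]; rewrite lee_fin.
  by rewrite !dotp0l /= mulr0 addr0 subr0 posdot_ge0.
by rewrite /= mul0r addr0 subr0 le_max lexx.
Qed.

Let posdot_le u a x : (0 <= a)%R -> dotp u u = 1%R ->
  (posdot u x)%:E <= conjugate (zero_or u) (cst 0%R) a x + a%:E.
Proof.
move=> a0 u1; rewrite -leeBlDr// -EFinB /posdot.
have [ux|ux] := leP (dotp u x) 0%R.
  apply: (@le_trans _ _ 0); first by rewrite lee_fin; lra.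
  by apply: conjugate_ge0 => //; left.
apply: le_trans (conjugate_ge _ _ _ (or_intror erefl)).
by rewrite lee_fin u1 /= mulr1 add0r.
Qed.

Let mposE u : measurable_fun setT (fun x : Rd R d => (posdot u x)%:E).
Proof. by apply/measurable_EFinP; exact: measurable_posdot. Qed.

Lemma integral_posdot_le alpha beta u a D : dotp u u = 1%R -> (0 < a)%R ->
  P1 beta -> weak_cost beta alpha <= D%:E ->
  \int[alpha]_x (posdot u x)%:E <=
    \int[beta]_x (posdot u x)%:E + (a + D / (2 * a))%:E.
Proof.
move=> u1 a0 P1b costD; have U0 : zero_or u 0%R by left.
have G0 : (cst 0%R : 'rV[R]_d -> R) 0%R = 0%R by [].
have conj0 s x : 0 <= conjugate (zero_or u) (cst 0%R) s x.
  exact: conjugate_ge0.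
have mconj s : measurable_fun setT (conjugate (zero_or u) (cst 0%R) s : Rd R d -> \bar R).
  exact: measurable_conjugate.
have := integral_conjugate_le U0 G0 0%R a0 (p := 1%R) _ P1b costD.
rewrite lexx ler01 add0r subrr mul0e add0e mul1e => /(_ isT) h.
apply: (@le_trans _ _ (\int[alpha]_x (conjugate (zero_or u) (cst 0%R) a x + a%:E))).
  apply: ge0_le_integral => //.
  - by move=> x _; rewrite lee_fin posdot_ge0.
  - exact: emeasurable_funD.
  - by move=> x _; apply: posdot_le => //; exact: ltW.
rewrite ge0_integralD//; last by move=> x _; rewrite lee_fin ltW.
rewrite integral_cst//= [X in _ * X]probability_setT mule1.
rewrite EFinD [X in _ <= _ + X]addeC addeA leeD2r//.
apply: (le_trans h); rewrite expr1n mul1r mulrC leeD2r//.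
by apply: ge0_le_integral => // x _; exact: conj_le.
Qed.

Section one_direction.
Variables (alpha : probability (Rd R d) R) (C M : R) (u : 'rV[R]_d).
Hypotheses (C0 : (0 < C)%R) (P1a : P1 alpha) (u1 : dotp u u = 1%R).
Hypothesis T2a : forall nu, P1 nu ->
  weak_cost alpha nu <= C%:E * rel_entropy nu alpha.
Hypothesis momM : \int[alpha]_x (posdot u x)%:E <= M%:E.

Let trunc (N : nat) x := Num.min (posdot u x) N%:R.

Let trunc_ge0 N x : (0 <= trunc N x)%R.
Proof. by rewrite le_min posdot_ge0 ler0n. Qed.

Let trunc_leN N x : (trunc N x <= N%:R)%R.
Proof. by rewrite ge_min lexx orbT. Qed.

Let trunc_le N x : (trunc N x <= posdot u x)%R.
Proof. by rewrite ge_min lexx. Qed.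

Let mtrunc N : measurable_fun setT (trunc N : Rd R d -> R).
Proof. by apply: measurable_minr => //; exact: measurable_posdot. Qed.

(* The T2 inequality is applied to the measure with density [exp (trunc N)],
   suitably normalized. *)
Let exp_trunc N : \int[alpha]_x (expR (trunc N x))%:E <= (expR (M + C / 2))%:E.
Proof.
have mexp : measurable_fun setT (fun x : Rd R d => expR (trunc N x)).
  exact: measurableT_comp.
have mexpE : measurable_fun setT (fun x : Rd R d => (expR (trunc N x))%:E).
  exact/measurable_EFinP.
have ZN : \int[alpha]_x (expR (trunc N x))%:E <= (expR N%:R)%:E.
  have -> : (expR N%:R)%:E = \int[alpha]_x (cst (expR N%:R)%:E x).
    by rewrite integral_cst// [X in _ * X]probability_setT mule1.
  by apply: ge0_le_integral => // x _; rewrite lee_fin ler_expR.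
have Z1 : 1 <= \int[alpha]_x (expR (trunc N x))%:E.
  have {1}-> : 1 = \int[alpha]_x (cst 1 x) :> \bar R.
    by rewrite integral_cst// mul1e; exact/esym/probability_setT.
  apply: ge0_le_integral => // x _; rewrite lee_fin.
  by rewrite -expR0 ler_expR.
have [Z ZE] : exists Z, \int[alpha]_x (expR (trunc N x))%:E = Z%:E.
  exists (fine (\int[alpha]_x (expR (trunc N x))%:E)); rewrite fineK//.
  by rewrite ge0_fin_numE ?(le_lt_trans ZN) ?ltry// (le_trans _ Z1).
rewrite ZE lee_fin in ZN; rewrite ZE lee_fin in Z1; rewrite ZE lee_fin.
have Z0 : (0 < Z)%R by exact: lt_le_trans Z1.
pose g (x : Rd R d) := (expR (trunc N x) / Z)%R.
have g0 x : (0 <= g x)%R by rewrite divr_ge0 ?expR_ge0// ltW.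
have mg : measurable_fun setT g by exact: measurable_funM.
have g1 : \int[alpha]_x (g x)%:E = 1.
  under eq_integral do rewrite /g mulrC EFinM.
  rewrite ge0_integralZl_EFin ?invr_ge0 ?(ltW Z0)//.
  by rewrite ZE -EFinM mulVf// gt_eqF.
pose nu : probability (Rd R d) R := density g0 mg g1.
have nuE A : measurable A -> nu A = \int[alpha]_(x in A) (g x)%:E by [].
have gN x : (g x <= expR N%:R)%R.
  rewrite /g ler_pdivrMr// (le_trans (_ : _ <= expR N%:R)%R) ?ler_expR//.
  by rewrite ler_peMr// expR_ge0.
have nu_fin h : measurable_fun setT h -> (forall x, 0 <= h x) ->
    \int[alpha]_x h x < +oo -> \int[nu]_x h x < +oo.
  move=> mh h0 hoo; rewrite (ge0_integral_density mg nuE)//.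
  apply: (@le_lt_trans _ _ (\int[alpha]_x (h x * (expR N%:R)%:E))).
    apply: ge0_le_integral => //.
    - by move=> x _; rewrite mule_ge0 ?lee_fin.
    - by apply: emeasurable_funM => //; exact/measurable_EFinP.
    - exact: emeasurable_funM.
    - by move=> x _; rewrite lee_wpmul2l ?lee_fin.
  rewrite ge0_integralZr ?lee_fin ?expR_ge0//.
  by rewrite muleC lte_mul_pinfty ?lee_fin ?expR_ge0.
have P1nu : P1 nu.
  apply: nu_fin => // [|x]; last by rewrite lee_fin eucl_norm_ge0.
  apply/measurable_EFinP; apply: measurable_eucl_norm => i.
  exact: measurable_coord.
pose H := \int[alpha]_x (entf (g x))%:E.
have HE : rel_entropy nu alpha = H by exact: rel_entropy_density.
have pos_ge0 (x : Rd R d) : 0 <= (posdot u x)%:E by rewrite lee_fin posdot_ge0.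
have gE0 (x : Rd R d) : 0 <= (g x)%:E by rewrite lee_fin.
have mgE : measurable_fun setT (EFin \o g) by exact/measurable_EFinP.
have mpg : measurable_fun setT (fun x : Rd R d => (posdot u x)%:E * (g x)%:E).
  exact: emeasurable_funM.
have pg0 (x : Rd R d) : 0 <= (posdot u x)%:E * (g x)%:E by exact: mule_ge0.
have ent0 x : 0 <= (entf (g x))%:E by rewrite lee_fin entf_ge0.
have ment : measurable_fun setT (fun x => (entf (g x))%:E).
  by apply/measurable_EFinP; exact: measurable_entf.
have H0 : 0 <= H by exact: integral_ge0.
have lnZ0 : (0 <= ln Z)%R by rewrite ln_ge0.
(* Since ln g = [trunc N] - ln Z, the entropy of the tilted measure nu is the nu-mean of [trunc N]
   minus ln Z, and [trunc N] is at most [posdot u]. *)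
have HlnZ : H + (ln Z)%:E <= \int[nu]_x (posdot u x)%:E.
  rewrite (ge0_integral_density mg nuE)//.
  have -> : (ln Z)%:E = \int[alpha]_x ((ln Z)%:E * (g x)%:E).
    by rewrite ge0_integralZl_EFin// g1 mule1.
  rewrite -(leeD2rE _ _ (_ : 1 \is a fin_num))//.
  have -> : H + \int[alpha]_x ((ln Z)%:E * (g x)%:E) + 1 =
      \int[alpha]_x (entf (g x) + ln Z * g x + g x)%:E.
    rewrite [RHS](eq_integral (fun x => (entf (g x))%:E + (ln Z)%:E * (g x)%:E +
      (g x)%:E))//.
    have lg0 (x : Rd R d) : 0 <= (ln Z)%:E * (g x)%:E by rewrite mule_ge0 ?lee_fin.
    have mlg : measurable_fun setT (fun x : Rd R d => (ln Z)%:E * (g x)%:E).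
      exact: measurable_funeM.
    rewrite ge0_integralD//; last 2 first.
    - by move=> x _; rewrite adde_ge0.
    - exact: emeasurable_funD.
    by rewrite g1 ge0_integralD.
  have e1 : 1 = \int[alpha]_x (cst 1 x) :> \bar R.
    by rewrite integral_cst// mul1e; exact/esym/probability_setT.
  rewrite [X in _ <= _ + X]e1 -ge0_integralD//; apply: ge0_le_integral => //.
  - by move=> x _; rewrite lee_fin addr_ge0// addr_ge0// ?entf_ge0// mulr_ge0.
  - apply/measurable_EFinP; apply: measurable_funD => //.
    apply: measurable_funD; first exact: measurable_entf.
    exact: measurable_funM.
  - exact: emeasurable_funD.
  - move=> x _; rewrite -EFinM -EFinD lee_fin.
    rewrite {1}/entf (_ : ln (g x) = trunc N x - ln Z)%R; last first.
      by rewrite /g ln_div ?posrE ?expR_gt0// expRK.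
    have : (g x * trunc N x <= g x * posdot u x)%R by rewrite ler_wpM2l.
    by lra.
have mom_nu : \int[nu]_x (posdot u x)%:E < +oo.
  by apply: nu_fin => //; rewrite (le_lt_trans momM) ?ltry.
have Hfin : H \is a fin_num.
  rewrite ge0_fin_numE// (le_lt_trans _ mom_nu)// (le_trans _ HlnZ)//.
  by rewrite leeDl// lee_fin.
have costH : weak_cost alpha nu <= (C * fine H)%:E.
  by apply: le_trans (T2a P1nu) _; rewrite HE EFinM fineK.
(* With a = C / 2 the comparison of moments costs C / 2 + H; the finite H cancels with the one on
   the left, leaving ln Z <= M + C / 2. *)
have C20 : (0 < C / 2)%R by rewrite divr_gt0.
have := integral_posdot_le u1 C20 P1a costH.
move=> /(le_trans HlnZ) /le_trans/(_ (leeD momM (lexx _))).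
rewrite -[H]fineK// -!EFinD lee_fin.
have -> : (C * fine H / (2 * (C / 2)) = fine H)%R by field; rewrite gt_eqF.
move=> h; have lnZM : (ln Z <= M + C / 2)%R by move: h; lra.
by rewrite -[Z]lnK ?posrE// ler_expR.
Qed.

(** The bound on exponential moments is uniform in the truncation level, and t^2 <= 2 e^t; monotone
    convergence removes the truncation. The constant depends on alpha only through C and M, which
    makes it uniform over a family. *)
Lemma integral_posdot_sqr : \int[alpha]_x (posdot u x ^+ 2)%:E <=
  (2 * expR (M + C / 2))%:E.
Proof.
have mt N : measurable_fun setT (fun x : Rd R d => (trunc N x ^+ 2)%:E).
  by apply/measurable_EFinP; exact: measurable_funX.
have bound N : \int[alpha]_x (trunc N x ^+ 2)%:E <= (2 * expR (M + C / 2))%:E.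
  rewrite EFinM; apply: le_trans (lee_wpmul2l _ (exp_trunc N)); last by rewrite lee_fin.
  have mexp : measurable_fun setT (fun x : Rd R d => (expR (trunc N x))%:E).
    by apply/measurable_EFinP; exact: measurableT_comp.
  rewrite -ge0_integralZl_EFin//.
  apply: ge0_le_integral => //.
  - by move=> x _; rewrite lee_fin sqr_ge0.
  - exact: measurable_funeM.
  - move=> x _; rewrite -EFinM lee_fin.
    have := @expR_ge1Dxn R (trunc N x) 1 (trunc_ge0 N x).
    by rewrite (_ : 2`!%:R = 2 :> R)%R//; lra.
have cv x : (trunc N x ^+ 2)%:E @[N --> \oo] --> (posdot u x ^+ 2)%:E.
  apply: cvg_near_cst; near=> N.
  rewrite /trunc (elimT min_idPl)//.
  near: N; exact: nbhs_infty_ger.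
rewrite (_ : \int[alpha]_x _ = limn (fun N => \int[alpha]_x (trunc N x ^+ 2)%:E)).
  apply: lime_le; last exact: nearW.
  apply: ereal_nondecreasing_is_cvgn => N N' NN'.
  apply: ge0_le_integral => //.
  - by move=> x _; rewrite lee_fin sqr_ge0.
  - move=> x _; rewrite lee_fin lerXn2r ?nnegrE//.
    by rewrite le_min trunc_le (le_trans (trunc_leN N x))// ler_nat.
rewrite -monotone_convergence//.
- by apply: eq_integral => x _; apply/esym/cvg_lim => //; exact: cv.
- by move=> N x _; rewrite lee_fin sqr_ge0.
- move=> x _ N N' NN'; rewrite lee_fin lerXn2r ?nnegrE//.
  by rewrite le_min trunc_le (le_trans (trunc_leN N x))// ler_nat.
Unshelve. all: by end_near. Qed.

End one_direction.

End second_moment.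

(** * From weights to couplings *)

Lemma integral_density d (T : measurableType d) (R : realType)
    (mu nu : probability T R) (g : T -> R) :
  (forall x, (0 <= g x)%R) -> measurable_fun setT g ->
  (forall A, measurable A -> nu A = \int[mu]_(x in A) (g x)%:E) ->
  forall h, measurable_fun setT h ->
  \int[nu]_x h x = \int[mu]_x (h x * (g x)%:E).
Proof.
move=> g0 mg nug h mh; rewrite integralE [RHS]integralE.
rewrite !(ge0_integral_density mg nug)//;
  [|exact: measurable_funeneg|exact: measurable_funepos].
have gE0 x : 0 <= (g x)%:E by rewrite lee_fin.
congr (_ - _); apply: eq_integral => x _.
  by rewrite !funeposE maxe_pMl// mul0e.
by rewrite !funenegE maxe_pMl// mul0e mulNe.
Qed.

Section coupling_of_weights.
Context {R : realType} {d : nat}.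
Variables (mu nu : probability (Rd R d) R) (I : finType) (k : Rd R d -> I)
  (b : I -> R) (m : I -> 'rV[R]_d) (c : I -> Rd R d -> R).
Let Q i := k @^-1` [set i].
Hypotheses (mQ : forall i, measurable (Q i)) (b0 : forall i, (0 < b i)%R)
  (muQ : forall i, mu (Q i) = (b i)%:E).
Hypotheses (c0 : forall i x, (0 <= c i x)%R) (c1 : forall x, (\sum_i c i x = 1)%R)
  (mc : forall i, measurable_fun setT (c i))
  (nuc : forall i, \int[nu]_x (c i x)%:E = (b i)%:E).
Hypothesis mu1 : forall j,
  mu.-integrable setT (fun y => ((y : 'rV[R]_d) 0%R j)%:E).
Hypothesis muQm : forall i j,
  \int[mu]_(y in Q i) ((y : 'rV[R]_d) 0%R j)%:E = (b i * m i 0%R j)%:E.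

(** Density of p_x with respect to mu: cell i is drawn with probability [c i x], then a point of mu
    conditioned on that cell. The same function is the density of the coupling with respect to the
    product of nu and mu. *)
Let g (z : Rd R d * Rd R d) : R := (\sum_i c i z.1 / b i * \1_(Q i) z.2)%R.

Let gE x y : g (x, y) = (c (k y) x / b (k y))%R.
Proof.
rewrite /g (bigD1 (k y))//= indicE mem_set// mulr1 big1 ?addr0// => i ik.
by rewrite indicE memNset ?mulr0// => /esym/eqP; rewrite (negbTE ik).
Qed.

Let g0 z : (0 <= g z)%R.
Proof.
by apply: sumr_ge0 => i _; rewrite mulr_ge0// divr_ge0// ltW.
Qed.

Let mg : measurable_fun setT g.
Proof.
apply: measurable_sum => i; apply: measurable_funM; last first.
  by apply: measurableT_comp => //; exact: measurable_indic.
apply: measurable_funM => //; exact: measurableT_comp.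
Qed.

Let mg1 x : measurable_fun setT (fun y => g (x, y)).
Proof. by apply: measurableT_comp => //; exact: measurable_pair1. Qed.

Let sum_cells (x : Rd R d) (h : Rd R d -> \bar R) : mu.-integrable setT h ->
  \int[mu]_y (h y * (g (x, y))%:E) =
  \sum_i (c i x / b i)%:E * \int[mu]_(y in Q i) h y.
Proof.
move=> ih.
transitivity (\int[mu]_y \sum_i ((c i x / b i)%:E * (h \_ (Q i)) y)).
  apply: eq_integral => y _; rewrite gE (bigD1 (k y))//= patchE mem_set// big1.
    by rewrite adde0 muleC.
  move=> i ik; rewrite patchE memNset ?mule0// => /esym/eqP.
  by rewrite (negbTE ik).
have iQ i : mu.-integrable setT (h \_ (Q i)).
  by apply/(integrable_mkcond _ (mQ i)).1; exact: integrableS ih.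
rewrite integral_sum//; last by move=> i; exact: integrableZl.
apply: eq_bigr => i _; rewrite integralZl//; congr (_ * _).
by rewrite [RHS]integral_mkcond.
Qed.

Let g_int x : \int[mu]_y (g (x, y))%:E = 1.
Proof.
transitivity (\int[mu]_y (cst 1 y * (g (x, y))%:E)).
  by apply: eq_integral => y _; rewrite mul1e.
rewrite (sum_cells x (h := cst 1)); last first.
  apply/integrableP; split; first exact: measurable_cst.
  by rewrite integral_cst//= normr1 mul1e [X in X < _]probability_setT ltry.
rewrite -[RHS](congr1 EFin (c1 x)) -sumEFin; apply: eq_bigr => i _.
by rewrite integral_cst ?mul1e// [X in _ * X]muQ -EFinM divfK// gt_eqF.
Qed.

Let p x : probability (Rd R d) R := density (fun y => g0 (x, y)) (mg1 x) (g_int x).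
Let p' (x : Rd R d) : {measure set Rd R d -> \bar R} := p x.

Let pE x B : p' x B = \int[mu]_(y in B) (g (x, y))%:E. Proof. by []. Qed.

Let mgE : measurable_fun setT (EFin \o g). Proof. exact/measurable_EFinP. Qed.

Let mp B : measurable B -> measurable_fun setT (fun x => p' x B).
Proof.
move=> mB; rewrite (_ : (fun _ => _) =
    fubini_F mu (fun z => (g z)%:E * (\1_B z.2)%:E)); last first.
  apply/funext => x; rewrite /fubini_F pE [LHS]integral_mkcond.
  apply: eq_integral => y _; rewrite patchE indicE.
  by case: ifPn => _; rewrite ?mule1 ?mule0.
apply: measurable_fun_fubini_tonelli_F => //.
  apply: emeasurable_funM => //; apply/measurable_EFinP.
  by apply: measurableT_comp => //; exact: measurable_indic.
by move=> z; rewrite mule_ge0// lee_fin.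
Qed.

HB.instance Definition _ := isKernel.Build _ _ _ _ _ p' mp.
HB.instance Definition _ := Kernel_isProbability.Build _ _ _ _ _ p'
  (fun x => @probability_setT _ _ _ (p x)).

Let prodM A B : measurable A -> measurable B ->
  \int[nu \x mu]_(z in A `*` B) (g z)%:E = \int[nu]_(x in A) p' x B.
Proof.
move=> mA mB; rewrite integral_mkcond fubini_tonelli1//; last 2 first.
- apply/(measurable_restrictT _ _).1; first exact: measurableX.
  exact: measurable_funTS.
- by move=> z; rewrite erestrict_ge0// => ? _; rewrite lee_fin.
rewrite [RHS]integral_mkcond; apply: eq_integral => x _.
rewrite /fubini_F patchE; case: ifPn => xA.
  rewrite pE [RHS]integral_mkcond; apply: eq_integral => y _.
  by rewrite !patchE in_setX xA.
rewrite integral0_eq// => y _.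
by rewrite patchE in_setX (negbTE xA).
Qed.

Let pi1 : \int[nu \x mu]_z (g z)%:E = 1.
Proof.
rewrite -setXTT prodM// -[RHS](@probability_setT _ _ _ nu) -[RHS]mul1e.
rewrite -integral_cst//; apply: eq_integral => x _; exact: (g_int x).
Qed.

Let pi : probability (Rd R d * Rd R d)%type R := density g0 mg pi1.

Let pi_coupling : coupling nu mu pi.
Proof.
split => [A mA|B mB].
  rewrite [LHS](prodM mA measurableT) -[RHS]mul1e -integral_cst//.
  by apply: eq_integral => x _; exact: g_int.
have -> : pi (setT `*` B) = \int[nu]_x \int[mu]_y ((g (x, y))%:E * (\1_B y)%:E).
  rewrite [LHS](prodM measurableT mB); apply: eq_integral => x _.
  rewrite pE [LHS]integral_mkcond; apply: eq_integral => y _.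
  by rewrite patchE indicE; case: ifPn => _; rewrite ?mule1 ?mule0.
have mgB : measurable_fun setT
    (fun z : Rd R d * Rd R d => (g z)%:E * (\1_B z.2)%:E).
  apply: emeasurable_funM => //; apply/measurable_EFinP.
  by apply: measurableT_comp => //; exact: measurable_indic.
have gB0 (z : Rd R d * Rd R d) : 0 <= (g z)%:E * (\1_B z.2)%:E.
  by rewrite mule_ge0// lee_fin.
rewrite (fubini_tonelli _ mgB gB0)/=.
transitivity (\int[mu]_y (\1_B y)%:E); last by rewrite integral_indic// setIT.
apply: eq_integral => y _.
transitivity (\int[nu]_x ((c (k y) x)%:E * ((b (k y))^-1 * \1_B y)%:E)).
  by apply: eq_integral => x _; rewrite gE -!EFinM mulrA.
rewrite ge0_integralZr ?lee_fin//.
- by rewrite nuc -EFinM mulrA divff ?mul1r// gt_eqF.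
- exact/measurable_EFinP.
- by move=> x _; rewrite lee_fin.
- by rewrite mulr_ge0// invr_ge0 ltW.
Qed.

(** The mean of cell i is [m i], so p_x has barycenter sum_i c_i(x) m_i; the second marginal is mu
    because [c i] has nu-mean [b i]. *)
Lemma weak_cost_le_weights : weak_cost mu nu <=
  \int[nu]_x (2^-1 *
    eucl_norm ((x : 'rV[R]_d) - \sum_i c i x *: m i)%R ^+ 2)%:E.
Proof.
apply: ereal_inf_lbound; exists pi, p'; split => //.
apply: eq_integral => x _; congr (_ * eucl_norm (_ - _) ^+ 2)%:E.
apply/rowP => j; rewrite summxE mxE /Rintegral.
have -> : \int[p' x]_y ((y : 'rV[R]_d) 0%R j)%:E =
    \int[mu]_y (((y : 'rV[R]_d) 0%R j)%:E * (g (x, y))%:E).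
  apply: (integral_density (fun y => g0 (x, y)) (mg1 x) (nu := p x)) => //.
  by apply/measurable_EFinP; exact: measurable_coord.
rewrite sum_cells// (eq_bigr (fun i => (c i x * m i 0%R j)%:E)).
  by rewrite sumEFin/=; apply: eq_bigr => i _; rewrite mxE.
by move=> i _; rewrite muQm -EFinM; congr EFin; field; rewrite gt_eqF.
Qed.

End coupling_of_weights.

(** * Quantization *)

Lemma measurable_comp_fin d d' (T : measurableType d) (T' : measurableType d')
    (I : finType) (k : T -> I) (h : I -> T') :
  (forall i, measurable (k @^-1` [set i])) -> measurable_fun setT (h \o k).
Proof.
move=> mk _ B mB; rewrite setTI.
rewrite (_ : _ @^-1` _ = \bigcup_(i in [set i | B (h i)]) k @^-1` [set i]).
  by apply: fin_bigcup_measurable => //; exact: finite_finset.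
apply/seteqP; split => [x Bx|x [i Bi /= kxi]]; first by exists (k x).
by rewrite /= kxi.
Qed.

Section grid.
Context {R : realType}.
Local Open Scope ring_scope.

(** Spacing 1 / (n + 1) from -(n + 1) to n + 1, both ends included. *)
Let levels n := (2 * n.+1 ^ 2).+1.

(** Out of range on either side the index falls back to 0: [Num.trunc] of a negative number is 0,
    and [inord] of a number that is too large is [ord0]. *)
Definition grid_index n (t : R) : 'I_(levels n) :=
  inord (Num.trunc ((t + n.+1%:R) * n.+1%:R)).

Definition grid_point n (l : 'I_(levels n)) : R := l%:R / n.+1%:R - n.+1%:R.

Lemma measurable_grid_index n l : measurable (grid_index n @^-1` [set l]).
Proof.
rewrite (_ : _ @^-1` _ = \bigcup_(v in [set v | inord v = l])
    ([set t | (t + n.+1%:R) * n.+1%:R < v.+1%:R] `&`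
     [set t | v%:R <= (Num.max 0 ((t + n.+1%:R) * n.+1%:R))])).
  apply: bigcup_measurable => v _.
  have mf : measurable_fun setT (fun t : R => (t + n.+1%:R) * n.+1%:R).
    by apply: measurable_funM => //; exact: measurable_funD.
  apply: measurableI; rewrite -[X in measurable X]setTI.
    exact: measurable_fun_ltr.
  by apply: measurable_fun_ler => //; exact: measurable_maxr.
apply/seteqP; split => [t <-|t [v <-]] /=.
  exists (Num.trunc ((t + n.+1%:R) * n.+1%:R)) => //=; split.
    exact: truncnS_gt.
  have [s0|s0] := leP 0 ((t + n.+1%:R) * n.+1%:R).
    by have /andP[] := truncn_itv s0.
  by rewrite (elimT (truncn0Pn _))// -ltNge (lt_trans s0).
move=> [ltv lev]; congr inord; apply/eqP; rewrite eqn_leq truncn_le_nat ltv/=.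
case: v lev {ltv} => // v; rewrite truncn_gt_nat le_max => /orP[|//].
by rewrite leNgt ltr0Sn.
Qed.

(** The first bound, uniform in n, provides domination; the second provides pointwise convergence.
    Out of range on both sides t is represented by the left end -(n + 1), so the error |t + n + 1|
    is at most 2 |t|, whence 4 t^2. *)
Lemma grid_error n t : let e := t - grid_point (grid_index n t) in
  e ^+ 2 <= 1 + 4 * t ^+ 2 /\ (`|t| <= n.+1%:R -> e ^+ 2 <= (n.+1%:R^-1) ^+ 2).
Proof.
have n0 : 0 < n.+1%:R :> R by rewrite ltr0Sn.
set e := t - _; pose s := (t + n.+1%:R) * n.+1%:R.
have n1 : n.+1%:R^-1 <= 1 :> R by rewrite invf_le1// ler1n.
have ninv0 : 0 < n.+1%:R^-1 :> R by rewrite invr_gt0.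
have tE : t = s / n.+1%:R - n.+1%:R by rewrite /s mulfK ?gt_eqF// addrK.
have [s0|s0] := ltP s 0.
  have t_n : t < - n.+1%:R by move: s0; rewrite pmulr_llt0//; lra.
  have eE : e = t + n.+1%:R.
    rewrite /e /grid_point /grid_index (elimT (truncn0Pn _)); last first.
      by rewrite -ltNge (lt_trans s0).
    by rewrite inordK// mul0r sub0r opprK.
  split; first by rewrite eE; nra.
  by rewrite ler_norml => /andP[]; lra.
have /andP[trl tru] := truncn_itv s0.
have [small|big] := leqP (Num.trunc s) (2 * n.+1 ^ 2).
  have e0 : 0 <= e.
    rewrite /e subr_ge0 {2}tE /grid_point /grid_index lerD2r ler_pM2r//.
    by rewrite inordK.
  have e1 : e <= n.+1%:R^-1.
    rewrite /e lerBlDr {1}tE /grid_point /grid_index addrA lerD2r.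
    rewrite -[X in _ <= X + _]mul1r -mulrDl ler_pM2r// inordK//.
    by rewrite -natr1 addrC in tru; exact: ltW.
  have : e ^+ 2 <= n.+1%:R^-1 ^+ 2 by rewrite lerXn2r// nnegrE// ltW.
  split => //; have := sqr_ge0 t.
  have : e ^+ 2 <= 1 by rewrite expr_le1// (le_trans e1).
  lra.
have t_n : n.+1%:R < t.
  have : (2 * n.+1 ^ 2)%:R < s.
    by apply: lt_le_trans trl; rewrite ltr_nat.
  rewrite natrM natrX expr2 mulrA ltr_pM2r// mulr_natl mulr2n.
  by rewrite ltrD2r.
split; last by rewrite ler_norml => /andP[]; lra.
have -> : e = t + n.+1%:R.
  rewrite /e /grid_point /grid_index /inord val_insubd /= ltnS leqNgt big/=.
  by rewrite mul0r sub0r opprK.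
nra.
Qed.

End grid.

Section quantization.
Context {R : realType} {d : nat}.
Variable mu : probability (Rd R d) R.
Hypothesis mu2 : \int[mu]_y (dotp y y)%:E < +oo.

Lemma integrable_coord_sqr j :
  mu.-integrable setT (fun y : Rd R d => ((y : 'rV[R]_d) 0%R j ^+ 2)%:E).
Proof.
apply/integrableP; split.
  by apply/measurable_EFinP; apply: measurable_funX; exact: measurable_coord.
apply: le_lt_trans mu2; apply: ge0_le_integral => //.
- apply: measurableT_comp => //; apply/measurable_EFinP; apply: measurable_funX.
  exact: measurable_coord.
- by apply/measurable_EFinP; apply: measurable_dotp => i; exact: measurable_coord.
- move=> y _; rewrite /= lee_fin ger0_norm ?sqr_ge0// /dotp (bigD1 j)//= expr2.
  by rewrite lerDl sumr_ge0// => i _; rewrite -expr2 sqr_ge0.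
Qed.

Let err n (j : 'I_d) (y : Rd R d) : R :=
  let t := (y : 'rV[R]_d) 0%R j in ((t - grid_point (grid_index n t)) ^+ 2)%R.

Let measurable_err n j : measurable_fun setT (err n j).
Proof.
apply: measurable_funX; apply: measurable_funB; first exact: measurable_coord.
rewrite (_ : (fun _ => _) = (@grid_point R n \o grid_index n) \o
    (fun y : Rd R d => (y : 'rV[R]_d) 0%R j))//.
apply: measurableT_comp; last exact: measurable_coord.
by apply: measurable_comp_fin => l; exact: measurable_grid_index.
Qed.

Let cvg_err j : \int[mu]_y (err n j y)%:E @[n --> \oo] --> 0.
Proof.
rewrite -[X in _ --> X](integral0 mu setT).
apply: (@dominated_cvg _ _ _ mu setT measurableT _ (cst 0)
    (fun y : Rd R d => (1 + 4 * (y : 'rV[R]_d) 0%R j ^+ 2)%:E)) => //.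
- by move=> n; apply/measurable_EFinP; exact: measurable_err.
- move=> y _; apply: cvg_EFin; first exact: nearW.
  apply: (@squeeze_cvgr _ _ _ _ (cst 0%R) (@harmonic R)); last 2 first.
  + exact: cvg_cst.
  + exact: cvg_harmonic.
  near=> n.
  have [_ h] := grid_error n ((y : 'rV[R]_d) 0%R j).
  rewrite /= sqr_ge0/= (le_trans (h _))//.
    rewrite (@le_trans _ _ n%:R)// ?ler_nat//; near: n; exact: nbhs_infty_ger.
  by rewrite expr2 ler_piMr ?invr_ge0// invf_le1// ler1n.
- apply: (eq_integrable measurableT
    (fun y : Rd R d => 1%:E + 4%:E * ((y : 'rV[R]_d) 0%R j ^+ 2)%:E)).
    by move=> y _; rewrite EFinD EFinM.
  apply: integrableD => //; last by apply: integrableZl => //; exact: integrable_coord_sqr.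
  exact: finite_measure_integrable_cst.
- move=> n y _; have [h _] := grid_error n ((y : 'rV[R]_d) 0%R j).
  by rewrite /= lee_fin ger0_norm ?sqr_ge0.
Unshelve. all: by end_near. Qed.

Lemma exists_grid (e : R) : (0 < e)%R ->
  exists (I : finType) (k : Rd R d -> I) (s : I -> 'rV[R]_d),
    (forall i, measurable (k @^-1` [set i])) /\
    \int[mu]_y (dotp ((y : 'rV[R]_d) - s (k y)) ((y : 'rV[R]_d) - s (k y))%R)%:E <= e%:E.
Proof.
move=> e0.
(* Dividing by d + 1 instead of d covers dimension 0. *)
have ed0 : (0 < e / d.+1%:R)%R by rewrite divr_gt0.
have : \forall n \near \oo, forall j : 'I_d,
    \int[mu]_y (err n j y)%:E <= (e / d.+1%:R)%:E.
  apply: filter_forall => j.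
  have /fine_cvgP[fin_err] := cvg_err j.
  move=> /cvgrPdist_le/(_ _ ed0) h; near=> n.
  have : \int[mu]_y (err n j y)%:E \is a fin_num by near: n.
  move=> /fineK <-; rewrite lee_fin.
  rewrite -[X in (X <= _)%R]ger0_norm; last first.
    by apply: fine_ge0; apply: integral_ge0 => y _; rewrite lee_fin sqr_ge0.
  by rewrite -normrN -sub0r; near: n.
move=> [n _ /(_ n (leqnn n)) errn].
exists {ffun 'I_d -> 'I_(2 * n.+1 ^ 2).+1}.
exists (fun y : Rd R d => [ffun j => grid_index n ((y : 'rV[R]_d) 0%R j)]).
exists (fun i : {ffun 'I_d -> 'I_(2 * n.+1 ^ 2).+1} =>
  \row_j @grid_point R n (i j)); split.
  move=> i; rewrite (_ : _ @^-1` _ = ~` (\bigcup_(j in setT)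
      ~` ((fun y : Rd R d => (y : 'rV[R]_d) 0%R j) @^-1`
        (grid_index n @^-1` [set i j])))).
    apply: measurableC; apply: fin_bigcup_measurable; first exact: finite_finset.
    move=> j _; apply: measurableC; rewrite -[X in measurable X]setTI.
    by apply: measurable_coord => //; exact: measurable_grid_index.
  rewrite setC_bigcup; under eq_bigcapr do rewrite setCK.
  apply/seteqP; split => [y <- j _ /=|y /= yi]; first by rewrite ffunE.
  by apply/ffunP => j; rewrite ffunE; exact: yi.
rewrite (eq_integral (fun y => \sum_(j < d) (err n j y)%:E)); last first.
  move=> y _; rewrite sumEFin; congr EFin; apply: eq_bigr => j _.
  by rewrite /err !mxE ffunE expr2.
rewrite ge0_integral_sum//; last 2 first.
- by move=> j; apply/measurable_EFinP; exact: measurable_err.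
- by move=> j y _; rewrite lee_fin sqr_ge0.
apply: (@le_trans _ _ (\sum_(j < d) (e / d.+1%:R)%:E)); first exact: lee_sum.
rewrite sumEFin lee_fin sumr_const card_ord -[X in (X <= _)%R]mulr_natr.
rewrite mulrAC ler_pdivrMr// ler_wpM2l ?ler_nat ?(ltW e0)//.
Unshelve. all: by end_near. Qed.

End quantization.

(** * Square-integrable functions, and cells represented by their means *)

Section square_integrable.
Context d (T : measurableType d) (R : realType) (mu : probability T R).
Implicit Types (f g : T -> R).
Local Open Scope ring_scope.

Definition sqintegrable f :=
  measurable_fun setT f /\ mu.-integrable setT (fun x => (f x ^+ 2)%:E).

Lemma sqintegrable_mul f g : sqintegrable f -> sqintegrable g ->
  mu.-integrable setT (fun x => (f x * g x)%:E).
Proof.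
move=> [mf i_f] [mg ig]; have ifg := integrableD measurableT i_f ig.
apply: le_integrable ifg => //.
  by apply/measurable_EFinP; exact: measurable_funM.
move=> x _; rewrite /= lee_fin [leRHS]ger0_norm ?addr_ge0 ?sqr_ge0//.
by rewrite ler_norml; apply/andP; split; nra.
Qed.

Lemma sqintegrable_bounded f M : measurable_fun setT f ->
  (forall x, `|f x| <= M) -> sqintegrable f.
Proof.
move=> mf fM; split => //.
apply: (@le_integrable _ _ _ _ setT measurableT _ (cst (M ^+ 2)%:E)) => //.
- by apply/measurable_EFinP; exact: measurable_funX.
- move=> x _; rewrite /= lee_fin ger0_norm ?sqr_ge0// ger0_norm ?sqr_ge0//.
  by rewrite -real_normK ?num_real// lerXn2r ?nnegrE// (le_trans _ (fM x)).
- exact: finite_measure_integrable_cst.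
Qed.

Lemma sqintegrable_cst c : sqintegrable (cst c).
Proof. exact: (@sqintegrable_bounded _ `|c|). Qed.

Lemma sqintegrable_integrable f : sqintegrable f -> mu.-integrable setT (EFin \o f).
Proof.
move=> sf; have := sqintegrable_mul sf (sqintegrable_cst 1).
by apply: eq_integrable => // x _; rewrite mulr1.
Qed.

Lemma sqintegrableD f g : sqintegrable f -> sqintegrable g ->
  sqintegrable (fun x => f x + g x).
Proof.
move=> sf sg; have [mf i_f] := sf; have [mg ig] := sg.
split; first exact: measurable_funD.
have ifg := sqintegrable_mul sf sg.
have := integrableD measurableT (integrableD measurableT i_f ig)
  (integrableZl measurableT 2 ifg).
by apply: eq_integrable => // x _; rewrite -EFinM -!EFinD; congr EFin; ring.
Qed.

Lemma sqintegrableZ c f : sqintegrable f -> sqintegrable (fun x => c * f x).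
Proof.
move=> [mf i_f]; split; first exact: measurable_funM.
have := integrableZl measurableT (c ^+ 2) i_f.
by apply: eq_integrable => // x _; rewrite -EFinM exprMn.
Qed.

Lemma sqintegrableB f g : sqintegrable f -> sqintegrable g ->
  sqintegrable (fun x => f x - g x).
Proof.
move=> sf sg; have := sqintegrableD sf (sqintegrableZ (-1) sg).
by rewrite (_ : (fun _ => _) = (fun x => f x - g x))//;
  apply/funext => x; rewrite mulN1r.
Qed.

Lemma sqintegrable_sum (I : Type) (s : seq I) (f : I -> T -> R) :
  (forall i, sqintegrable (f i)) -> sqintegrable (fun x => \sum_(i <- s) f i x).
Proof.
move=> sf; elim: s => [|i s ih].
  rewrite (_ : (fun _ => _) = cst 0); first exact: sqintegrable_cst.
  by apply/funext => x; rewrite big_nil.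
rewrite (_ : (fun _ => _) = (fun x => f i x + \sum_(i <- s) f i x)).
  exact: sqintegrableD.
by apply/funext => x; rewrite big_cons.
Qed.

Lemma mean_minimizes_variance f (Q : set T) (b m s : R) : sqintegrable f ->
  measurable Q -> mu Q = b%:E ->
  (\int[mu]_(x in Q) (f x)%:E = (b * m)%:E)%E ->
  (\int[mu]_(x in Q) ((f x - m) ^+ 2)%:E <= \int[mu]_(x in Q) ((f x - s) ^+ 2)%:E)%E.
Proof.
move=> sf mQ muQ fm.
have b0 : 0 <= b by rewrite -lee_fin -muQ.
have [_ iv] := sqintegrableB sf (sqintegrable_cst m).
have i1 := sqintegrable_integrable sf.
have ivQ : mu.-integrable Q (fun x => ((f x - m) ^+ 2)%:E).
  exact: integrableS iv.
have i1Q : mu.-integrable Q (fun x => (2 * (m - s))%:E * (f x)%:E)%E.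
  by apply: integrableZl => //; exact: integrableS i1.
have icQ : mu.-integrable Q (cst ((m - s) ^+ 2 - 2 * (m - s) * m)%:E).
  by apply: finite_measure_integrable_cst.
rewrite [leRHS](_ : _ = \int[mu]_(x in Q) (((f x - m) ^+ 2)%:E +
    ((2 * (m - s))%:E * (f x)%:E + cst ((m - s) ^+ 2 - 2 * (m - s) * m)%:E x)))%E; last first.
  by apply: eq_integral => x _; rewrite -EFinM -!EFinD; congr EFin; ring.
rewrite integralD//; last exact: integrableD.
rewrite leeDl// integralD// integral_cst// integralZl//; last exact: integrableS i1.
rewrite fm [X in (_ + _ * X)%E]muQ -!EFinM -EFinD lee_fin.
rewrite [leRHS](_ : _ = (m - s) ^+ 2 * b); last by ring.
by rewrite mulr_ge0// sqr_ge0.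
Qed.

End square_integrable.

Section finite_partition.
Context d (T : measurableType d) (R : realType) (mu : {measure set T -> \bar R}).
Variables (I : finType) (k : T -> I).
Hypothesis mk : forall i, measurable (k @^-1` [set i]).

Lemma measurable_preimage_fin (P : set I) : measurable (k @^-1` P).
Proof.
rewrite (_ : _ @^-1` _ = \bigcup_(i in P) k @^-1` [set i]).
  by apply: fin_bigcup_measurable => //; exact: finite_finset.
apply/seteqP; split => [x Px|x [i Pi /= kxi]]; first by exists (k x).
by rewrite /preimage/= kxi.
Qed.

Lemma ge0_integral_fin_partition h : measurable_fun setT h -> (forall x, 0 <= h x) ->
  \int[mu]_x h x = \sum_i \int[mu]_(x in k @^-1` [set i]) h x.
Proof.
move=> mh h0.
transitivity (\int[mu]_x \sum_i (h \_ (k @^-1` [set i])) x).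
  apply: eq_integral => x _; rewrite (bigD1 (k x))//= patchE mem_set// big1 ?adde0//.
  move=> i ik; rewrite patchE memNset// => /esym/eqP.
  by rewrite (negbTE ik).
rewrite ge0_integral_sum//; last 2 first.
- by move=> i; apply/(measurable_restrictT _ _).1 => //; exact: measurable_funTS.
- by move=> i x _; exact: erestrict_ge0.
by apply: eq_bigr => i _; rewrite -integral_mkcond.
Qed.

Lemma measure_fin_partition (P : set I) :
  (forall i, P i -> mu (k @^-1` [set i]) = 0) -> mu (k @^-1` P) = 0.
Proof.
move=> P0; have mP := measurable_preimage_fin P.
rewrite -(setIT (k @^-1` P)) -integral_indic//.
rewrite ge0_integral_fin_partition//; last first.
  by apply/measurable_EFinP; exact: measurable_indic.
rewrite big1// => i _; have [Pi|Pi] := pselect (P i).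
  by apply: null_set_integral => //; [apply/measurable_EFinP;
    exact/measurable_funTS/measurable_indic|exact: P0].
by apply: integral0_eq => x /= kx; rewrite indicE memNset//= kx.
Qed.

End finite_partition.

Section quantization_by_means.
Context {R : realType} {d : nat}.
Variable mu : probability (Rd R d) R.
Hypothesis mu2 : \int[mu]_y (dotp y y)%:E < +oo.

Lemma sqintegrable_coord j :
  sqintegrable mu (fun y : Rd R d => (y : 'rV[R]_d) 0%R j).
Proof. by split; [exact: measurable_coord|exact: integrable_coord_sqr]. Qed.

Definition quantizer (I : finType) (k : Rd R d -> I) (b : I -> R) (m : I -> 'rV[R]_d) :=
  [/\ forall i, measurable (k @^-1` [set i]), forall i, (0 < b i)%R,
      forall i, mu (k @^-1` [set i]) = (b i)%:E &
      forall i j, \int[mu]_(y in k @^-1` [set i]) ((y : 'rV[R]_d) 0%R j)%:E =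
        (b i * m i 0%R j)%:E].

(** Null cells of the grid are merged into a cell of positive mass, since the masses will be
    divisors; this changes the map on a null set only. Replacing the representatives by the cell
    means then does not increase the error. *)
Lemma exists_quantizer (e : R) : (0 < e)%R -> exists (I : finType) k b m,
  @quantizer I k b m /\
  \int[mu]_y (dotp ((y : 'rV[R]_d) - m (k y)) ((y : 'rV[R]_d) - m (k y))%R)%:E <= e%:E.
Proof.
move=> e0; have [I [k [s [mk errk]]]] := exists_grid mu2 e0.
pose beta i := fine (mu (k @^-1` [set i])).
have betaE i : mu (k @^-1` [set i]) = (beta i)%:E.
  by rewrite /beta fineK// fin_num_measure.
have beta_ge0 i : (0 <= beta i)%R by exact: fine_ge0.
have null : mu (k @^-1` [set i | ~~ (0 < beta i)%R]) = 0.
  apply: measure_fin_partition => // i /= bi; rewrite [LHS]betaE; congr EFin.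
  by apply/eqP; rewrite eq_le beta_ge0 leNgt bi.
have [i0 bi0] : exists i, (0 < beta i)%R.
  apply: contrapT => nob; have := @probability_setT _ _ _ mu.
  rewrite (_ : setT = k @^-1` [set i | ~~ (0 < beta i)%R]) => [|].
    by rewrite [X in X = _]null => /eqP; rewrite eq_sym onee_eq0.
  by apply/seteqP; split => // y _ /=; apply/negP => h; apply: nob; exists (k y).
pose J := {i : I | (0 < beta i)%R}; pose j0 : J := exist _ i0 bi0.
pose k' y : J := insubd j0 (k y).
have k'E j : k' @^-1` [set j] = k @^-1` [set i | insubd j0 i = j] by [].
have mk' j : measurable (k' @^-1` [set j]).
  by rewrite k'E; exact: measurable_preimage_fin.
pose b j := fine (mu (k' @^-1` [set j])).
have muk' j : mu (k' @^-1` [set j]) = (b j)%:E by rewrite /b fineK// fin_num_measure.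
have b0 j : (0 < b j)%R.
  rewrite -lte_fin -muk'; apply: (@lt_le_trans _ _ (beta (val j))%:E).
    by rewrite lte_fin; exact: (valP j).
  rewrite -betaE; apply: le_measure; rewrite ?inE//.
  by move=> y /= kj; rewrite /k' kj valKd.
pose m j : 'rV[R]_d :=
  \row_l (fine (\int[mu]_(y in k' @^-1` [set j]) ((y : 'rV[R]_d) 0%R l)%:E) / b j)%R.
have sc := sqintegrable_coord.
have mE j l : \int[mu]_(y in k' @^-1` [set j]) ((y : 'rV[R]_d) 0%R l)%:E =
    (b j * m j 0%R l)%:E.
  rewrite mxE mulrC divfK ?gt_eqF// fineK//.
  by apply: integrable_fin_num => //; apply: (integrableS measurableT) => //;
    exact: (sqintegrable_integrable (sc l)).
exists J, k', b, m; split; first by split.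
apply: le_trans errk.
have mcomp (s' : J -> 'rV[R]_d) l :
    measurable_fun setT (fun y : Rd R d => ((y : 'rV[R]_d) - s' (k' y))%R 0%R l).
  rewrite (_ : (fun _ => _) =
      (fun y : Rd R d => (y : 'rV[R]_d) 0%R l - ((fun j => s' j 0%R l) \o k') y)%R).
    apply: measurable_funB; first exact: measurable_coord.
    exact: measurable_comp_fin.
  by apply/funext => y; rewrite !mxE.
have merr s' : measurable_fun setT (fun y : Rd R d =>
    (dotp ((y : 'rV[R]_d) - s' (k' y)) ((y : 'rV[R]_d) - s' (k' y))%R)%:E).
  by apply/measurable_EFinP; exact: measurable_dotp.
have mks l : measurable_fun setT (fun y : Rd R d => ((y : 'rV[R]_d) - s (k y))%R 0%R l).
  rewrite (_ : (fun _ => _) =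
      (fun y : Rd R d => (y : 'rV[R]_d) 0%R l - ((fun i => s i 0%R l) \o k) y)%R).
    by apply: measurable_funB; [exact: measurable_coord|exact: measurable_comp_fin].
  by apply/funext => y; rewrite !mxE.
rewrite [leRHS](_ : _ = \int[mu]_y (dotp ((y : 'rV[R]_d) - s (val (k' y)))
    ((y : 'rV[R]_d) - s (val (k' y)))%R)%:E); last first.
  apply: ae_eq_integral => //.
  - by apply/measurable_EFinP; exact: measurable_dotp.
  - exact: (merr (s \o val)).
  - exists (k @^-1` [set i | ~~ (0 < beta i)%R]); split => //.
      exact: measurable_preimage_fin.
    move=> y /= h; apply/negP => ky; apply: h => _.
    by rewrite /k' insubdK.
have split_coord (s' : J -> 'rV[R]_d) :
    \int[mu]_y (dotp ((y : 'rV[R]_d) - s' (k' y)) ((y : 'rV[R]_d) - s' (k' y))%R)%:E =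
    \sum_(l < d) \sum_j \int[mu]_(y in k' @^-1` [set j])
      (((y : 'rV[R]_d) 0%R l - s' j 0%R l) ^+ 2)%:E.
  rewrite (eq_integral (fun y : Rd R d => \sum_(l < d)
      ((((y : 'rV[R]_d) - s' (k' y))%R 0%R l) ^+ 2)%:E)); last first.
    by move=> y _; rewrite sumEFin; congr EFin; apply: eq_bigr => l _; rewrite expr2.
  rewrite ge0_integral_sum//; last 2 first.
  - by move=> l; apply/measurable_EFinP; exact: measurable_funX.
  - by move=> l y _; rewrite lee_fin sqr_ge0.
  apply: eq_bigr => l _; rewrite (ge0_integral_fin_partition _ mk')//; last 2 first.
  - by apply/measurable_EFinP; exact: measurable_funX.
  - by move=> y; rewrite lee_fin sqr_ge0.
  apply: eq_bigr => j _; apply: eq_integral => y; rewrite inE/= => ky.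
  by rewrite !mxE ky.
rewrite split_coord (split_coord (s \o val)); apply: lee_sum => l _.
apply: lee_sum => j _; apply: mean_minimizes_variance => //; exact: muk'.
Qed.

End quantization_by_means.

(** * Penalized minimization and duality *)

Section penalized_cost.
Context {R : realType} {d : nat}.
Variables (nu : probability (Rd R d) R) (I : finType) (b : I -> R)
  (m : I -> 'rV[R]_d).
Hypothesis nu2 : \int[nu]_x (dotp x x)%:E < +oo.
Hypothesis b1 : (\sum_i b i = 1)%R.
Hypothesis b_ge0 : forall i, (0 <= b i)%R.
Local Open Scope ring_scope.
Implicit Types c q : I -> Rd R d -> R.

Local Notation sqi := (sqintegrable nu).

Definition weights c := [/\ forall i, measurable_fun setT (c i),
  forall i x, 0 <= c i x & forall x, \sum_i c i x = 1].

Definition wbar c (x : Rd R d) : 'rV[R]_d := \sum_i c i x *: m i.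

Definition residue c (x : Rd R d) : 'rV[R]_d := (x : 'rV[R]_d) - wbar c x.

Definition wcost c : R := 2^-1 * \int[nu]_x dotp (residue c x) (residue c x).

Definition wgap c i : R := (\int[nu]_x c i x) - b i.

(** The marginal constraint int c_i dnu = b_i is relaxed to a quadratic penalty, whose derivative
    [wgap c i] / eta will serve, up to sign, as a Lagrange multiplier. *)
Definition penalized eta c : R := wcost c + (2 * eta)^-1 * \sum_i wgap c i ^+ 2.

Definition mix_weights t c q i (x : Rd R d) : R := c i x + t * (q i x - c i x).

Let direction c q (x : Rd R d) : 'rV[R]_d := \sum_i (q i x - c i x) *: m i.

Lemma weights_le1 c i x : weights c -> c i x <= 1.
Proof.
by move=> [_ c0 c1]; rewrite -(c1 x) (bigD1 i)//= lerDl sumr_ge0.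
Qed.

Lemma sqi_weights c i : weights c -> sqi (c i).
Proof.
move=> wc; have [mc c0 _] := wc; apply: (@sqintegrable_bounded _ _ _ _ _ 1) => //.
by move=> x; rewrite ger0_norm// weights_le1.
Qed.

Lemma weights_cst : weights (fun i => cst (b i)).
Proof. by split => [i|i x|x] //=; exact: b_ge0. Qed.

Lemma weights_mix t c q : 0 <= t <= 1 -> weights c -> weights q ->
  weights (mix_weights t c q).
Proof.
move=> /andP[t0 t1] wc wq; have [mc c0 c1] := wc; have [mq q0 q1] := wq.
split => [i|i x|x].
- apply: measurable_funD => //; apply: measurable_funM => //.
  exact: measurable_funB.
- have := c0 i x; have := q0 i x; rewrite /mix_weights; nra.
- by rewrite big_split/= -mulr_sumr sumrB c1 q1 subrr mulr0 addr0.
Qed.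

Lemma sqi_wbar c j : weights c -> sqi (fun x => wbar c x 0 j).
Proof.
move=> wc; rewrite (_ : (fun _ => _) = fun x => \sum_i m i 0 j * c i x).
  by apply: sqintegrable_sum => i; apply: sqintegrableZ; exact: sqi_weights.
apply/funext => x; rewrite /wbar summxE; apply: eq_bigr => i _.
by rewrite mxE mulrC.
Qed.

Lemma sqi_coord j : sqi (fun x : Rd R d => (x : 'rV[R]_d) 0 j).
Proof. exact: sqintegrable_coord. Qed.

Lemma sqi_residue c j : weights c -> sqi (fun x => residue c x 0 j).
Proof.
move=> wc; rewrite (_ : (fun _ => _) = fun x => (x : 'rV[R]_d) 0 j - wbar c x 0 j).
  by apply: sqintegrableB; [exact: sqi_coord|exact: sqi_wbar].
by apply/funext => x; rewrite 2!mxE.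
Qed.

Lemma directionE c q x : direction c q x = wbar q x - wbar c x.
Proof.
by rewrite /direction /wbar -sumrB; apply: eq_bigr => i _; rewrite scalerBl.
Qed.

Let sqi_direction c q j : weights c -> weights q ->
  sqi (fun x => direction c q x 0 j).
Proof.
move=> wc wq; rewrite (_ : (fun _ => _) = fun x => wbar q x 0 j - wbar c x 0 j).
  by apply: sqintegrableB; exact: sqi_wbar.
by apply/funext => x; rewrite directionE !mxE.
Qed.

Lemma integrable_dotp (f g : Rd R d -> 'rV[R]_d) :
  (forall j, sqi (fun x => f x 0 j)) -> (forall j, sqi (fun x => g x 0 j)) ->
  nu.-integrable setT (fun x => (dotp (f x) (g x))%:E).
Proof.
move=> sf sg; rewrite (_ : (fun _ => _) =
    (fun x => \sum_(j < d) (f x 0 j * g x 0 j)%:E)%E); last first.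
  by apply/funext => x; rewrite sumEFin.
by apply: integrable_sum => // j _; exact: sqintegrable_mul.
Qed.

Lemma integrable_weights c i : weights c -> nu.-integrable setT (EFin \o c i).
Proof. by move=> wc; apply: sqintegrable_integrable; exact: sqi_weights. Qed.

Let B : R := 2^-1 * (\sum_(j < d) (\sum_i `|m i 0 j|) ^+ 2).

Let direction_le c q x : weights c -> weights q ->
  2^-1 * dotp (direction c q x) (direction c q x) <= B.
Proof.
move=> wc wq; rewrite ler_wpM2l// /dotp; apply: ler_sum => j _.
rewrite -expr2 -real_normK ?num_real// lerXn2r ?nnegrE ?sumr_ge0//.
rewrite /direction summxE (le_trans (ler_norm_sum _ _ _))//.
apply: ler_sum => i _; rewrite mxE normrM ler_piMl// ler_norml.
have [_ c0 _] := wc; have [_ q0 _] := wq.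
have := weights_le1 i x wc; have := weights_le1 i x wq.
by have := c0 i x; have := q0 i x; move=> *; apply/andP; split; lra.
Qed.

Let RintegralT_cst (r : R) : \int[nu]_x (cst r x) = r.
Proof.
by rewrite Rintegral_cst//= [X in fine X]probability_setT mulr1.
Qed.

(** Second-order expansion along the segment from c to q. The bracket is minus the derivative at c;
    the remainder is uniform in c and q because |q_i - c_i| <= 1 bounds the displacement of the
    barycenter and the change of each marginal mass. *)
Lemma penalized_mix eta t c q : 0 < eta -> 0 <= t <= 1 -> weights c -> weights q ->
  penalized eta (mix_weights t c q) <= penalized eta c
   - t * (\int[nu]_x dotp (residue c x) (direction c q x) -
          eta^-1 * \sum_i wgap c i * (\int[nu]_x (q i x - c i x)))
   + t ^+ 2 * (B + (2 * eta)^-1 * #|I|%:R).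
Proof.
move=> eta0 t01 wc wq.
have sv j := sqi_residue j wc; have sw j := sqi_direction j wc wq.
have ivv := integrable_dotp sv sv; have ivw := integrable_dotp sv sw.
have iww := integrable_dotp sw sw.
have res x : residue (mix_weights t c q) x = residue c x - t *: direction c q x.
  rewrite /residue /wbar /direction -addrA -opprD scaler_sumr -big_split/=.
  by congr (_ - _); apply: eq_bigr => i _; rewrite scalerDl scalerA.
have cost_eq : wcost (mix_weights t c q) = wcost c -
    t * (\int[nu]_x dotp (residue c x) (direction c q x)) +
    t ^+ 2 * (\int[nu]_x (2^-1 * dotp (direction c q x) (direction c q x))).
  rewrite /wcost RintegralZl//.
  rewrite (@eq_Rintegral _ _ _ _ _ (fun x => dotp (residue c x) (residue c x) +
     (- (2 * t)) * dotp (residue c x) (direction c q x) +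
     t ^+ 2 * dotp (direction c q x) (direction c q x))); last first.
    move=> x _; rewrite res /dotp !mulr_sumr -!big_split/=.
    by apply: eq_bigr => j _; rewrite !mxE; ring.
  have ia : nu.-integrable setT (fun x =>
      (- (2 * t) * dotp (residue c x) (direction c q x))%:E).
    by under eq_fun do rewrite EFinM; exact: integrableZl.
  have ib : nu.-integrable setT (fun x =>
      (t ^+ 2 * dotp (direction c q x) (direction c q x))%:E).
    by under eq_fun do rewrite EFinM; exact: integrableZl.
  rewrite RintegralD//; last exact: (integrableD measurableT ivv ia).
  by rewrite RintegralD// !RintegralZl//; field.
have gap_eq i : wgap (mix_weights t c q) i =
    wgap c i + t * \int[nu]_x (q i x - c i x).
  have ic := integrable_weights i wc; have iq := integrable_weights i wq.
  have iqc : nu.-integrable setT (fun x => (q i x - c i x)%:E).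
    by under eq_fun do rewrite EFinB; exact: integrableB.
  have itqc : nu.-integrable setT (fun x => (t * (q i x - c i x))%:E).
    by under eq_fun do rewrite EFinM; exact: integrableZl.
  by rewrite /wgap /mix_weights RintegralD// RintegralZl//; ring.
have rho_le i : (\int[nu]_x (q i x - c i x)) ^+ 2 <= 1.
  have ic := integrable_weights i wc; have iq := integrable_weights i wq.
  have [_ c0 _] := wc; have [_ q0 _] := wq.
  have E01 f : nu.-integrable setT (EFin \o f) -> (forall x, 0 <= f x <= 1) ->
      0 <= \int[nu]_x f x <= 1.
    move=> i_f f01; apply/andP; split.
      by apply: Rintegral_ge0 => x _; have /andP[] := f01 x.
    rewrite -[leRHS](RintegralT_cst 1); apply: le_Rintegral => //.
      exact: finite_measure_integrable_cst.
    by move=> x _; have /andP[] := f01 x.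
  have /andP[? ?] : 0 <= \int[nu]_x c i x <= 1.
    by apply: E01 => // x; rewrite c0 weights_le1.
  have /andP[? ?] : 0 <= \int[nu]_x q i x <= 1.
    by apply: E01 => // x; rewrite q0 weights_le1.
  by rewrite RintegralB//; nra.
rewrite /penalized cost_eq.
have int_le : \int[nu]_x (2^-1 * dotp (direction c q x) (direction c q x)) <= B.
  rewrite -[leRHS](RintegralT_cst B); apply: le_Rintegral => //.
  - exact: (integrableZl measurableT 2^-1 iww).
  - exact: finite_measure_integrable_cst.
  - by move=> x _; exact: direction_le.
have gap_le : \sum_i wgap (mix_weights t c q) i ^+ 2 <= \sum_i wgap c i ^+ 2 +
    2 * t * (\sum_i wgap c i * \int[nu]_x (q i x - c i x)) + t ^+ 2 * #|I|%:R.
  rewrite -[#|I|%:R]sumr_const mulr_sumr [X in _ + X]mulr_sumr -!big_split/=.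
  apply: ler_sum => i _; rewrite gap_eq.
  have := rho_le i; set rho := (\int[nu]_x _) => h.
  have : t ^+ 2 * rho ^+ 2 <= t ^+ 2 * 1 by rewrite ler_wpM2l// sqr_ge0.
  by move=> h'; lra.
have eta2 : 0 < (2 * eta)^-1 by rewrite invr_gt0 mulr_gt0.
have := ler_wpM2l (ltW eta2) gap_le.
have := ler_wpM2l (sqr_ge0 t) int_le.
have -> : eta^-1 = 2 * (2 * eta)^-1 by field; rewrite gt_eqF.
set e2 := (2 * eta)^-1; set S1 := \sum_i wgap (mix_weights t c q) i ^+ 2.
set S2 := \sum_i wgap c i ^+ 2; set S3 := \sum_i wgap c i * _.
set J1 := \int[nu]_x (2^-1 * _); set J2 := \int[nu]_x dotp _ _.
lra.
Qed.

(** Take c within t e / 2 of the infimum, with t so small that the second-order term is at most t e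
    / 2: a rate of descent above e would bring the segment below the infimum. *)
Lemma exists_almost_critical eta (e : R) : 0 < eta -> 0 < e ->
  exists2 c, weights c & forall q, weights q ->
    \int[nu]_x dotp (residue c x) (direction c q x) -
      eta^-1 * \sum_i wgap c i * (\int[nu]_x (q i x - c i x)) <= e.
Proof.
move=> eta0 e0; pose D := B + (2 * eta)^-1 * #|I|%:R + 1.
have B0 : 0 <= B by rewrite mulr_ge0// sumr_ge0// => j _; exact: sqr_ge0.
have eta2 : 0 < (2 * eta)^-1 by rewrite invr_gt0 mulr_gt0.
have D0 : 0 < D by rewrite ltr_wpDl// addr_ge0// mulr_ge0// ltW.
pose t := Num.min 1 (e / (2 * D)).
have t0 : 0 < t by rewrite lt_min ltr01 divr_gt0// mulr_gt0.
have t1 : t <= 1 by rewrite ge_min lexx.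
have tD : t * D <= e / 2.
  rewrite -ler_pdivlMr// -mulrA -invfM.
  by rewrite ge_min lexx orbT.
pose vals := [set penalized eta c | c in weights].
have [] := @inf_adherent _ vals (t * e / 2).
- by rewrite divr_gt0// mulr_gt0.
- split; first by exists (penalized eta (fun i => cst (b i))), (fun i => cst (b i)) => //;
    exact: weights_cst.
  exists 0 => _ [c _ <-]; rewrite addr_ge0//.
    by rewrite mulr_ge0// Rintegral_ge0// => x _; exact: dotpxx_ge0.
  by rewrite mulr_ge0 ?(ltW eta2)// sumr_ge0// => i _; exact: sqr_ge0.
move=> _ [c wc <-] cmin; exists c => // q wq.
have := @penalized_mix eta t c q eta0 _ wc wq; rewrite (ltW t0) t1 => /(_ isT) h.
have : inf vals <= penalized eta (mix_weights t c q).
  apply: inf_lbound; last first.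
    by exists (mix_weights t c q) => //; apply: weights_mix => //; rewrite (ltW t0).
  exists 0 => _ [c' _ <-]; rewrite addr_ge0//.
    by rewrite mulr_ge0// Rintegral_ge0// => x _; exact: dotpxx_ge0.
  by rewrite mulr_ge0 ?(ltW eta2)// sumr_ge0// => i _; exact: sqr_ge0.
set L := (X in X <= e); rewrite -/L in h.
have h3 : t * (t * D) <= t * (e / 2) by rewrite ler_wpM2l// ltW.
have hD : B + (2 * eta)^-1 * #|I|%:R = D - 1 by rewrite /D addrK.
rewrite hD in h; move=> h2.
have tL : t * L <= t * e.
  have := sqr_ge0 t; move: h h2 h3 cmin.
  set P1 := penalized eta _; set P2 := penalized eta _.
  lra.
by move: tL; rewrite ler_pM2l.
Qed.

End penalized_cost.

(** The index depends on x only through the finite table of comparisons between the values, which is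
    measurable in x, so any selection from the table is measurable. The default [i0] in [best] is
    never reached on the table of an actual x. *)
Lemma exists_measurable_argmax d (T : measurableType d) (R : realType)
    (I : finType) (i0 : I) (f : I -> T -> R) :
  (forall i, measurable_fun setT (f i)) ->
  exists idx : T -> I, (forall i, measurable (idx @^-1` [set i])) /\
    forall x j, (f j x <= f (idx x) x)%R.
Proof.
move=> mf; pose table x : {ffun I * I -> bool} := [ffun p => (f p.1 x <= f p.2 x)%R].
pose best (A : {ffun I * I -> bool}) := odflt i0 [pick l | [forall j, A (j, l)]].
have mtable A : measurable (table @^-1` [set A]).
  rewrite (_ : _ @^-1` _ = ~` (\bigcup_(p in setT)
      ~` ((fun x => (f p.1 x <= f p.2 x)%R) @^-1` [set A p]))).
    apply: measurableC; apply: fin_bigcup_measurable; first exact: finite_finset.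
    move=> p _; apply: measurableC; rewrite -[X in measurable X]setTI.
    exact: measurable_fun_ler.
  rewrite setC_bigcup; under eq_bigcapr do rewrite setCK.
  apply/seteqP; split => [x <- p _ /=|x /= xA]; first by rewrite ffunE.
  by apply/ffunP => p; rewrite ffunE; exact: xA.
exists (best \o table); split => [i|x j].
  exact: (measurable_preimage_fin mtable [set A | best A = i]).
rewrite /best /=; case: pickP => [l /forallP/(_ j)|/=]; first by rewrite ffunE.
pose l := [arg max_(l > i0) f l x]%O.
have lmax j' : (f j' x <= f l x)%R by rewrite /l; case: arg_maxP => // i _; exact.
by move=> /(_ l) /negP[]; apply/forallP => j'; rewrite ffunE.
Qed.

(** * The dual function of an almost critical point *)

Section dual_certificate.
Context {R : realType} {d : nat}.
Variables (mu nu : probability (Rd R d) R) (I : finType) (k : Rd R d -> I)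
  (b : I -> R) (m : I -> 'rV[R]_d) (i0 : I).
Hypothesis nu2 : \int[nu]_x (dotp x x)%:E < +oo.
Hypothesis quant : quantizer mu k b m.
Variables (delta Ct : R).
Hypothesis err : \int[mu]_y
  (dotp ((y : 'rV[R]_d) - m (k y)) ((y : 'rV[R]_d) - m (k y))%R)%:E <= delta%:E.
Hypothesis dual : forall (G : 'rV[R]_d -> R) (a : R), G 0%R = 0%R -> (0 < a)%R ->
  \int[nu]_x conjugate setT G a x <= \int[mu]_x conjugate setT G 0 x + (Ct / (2 * a))%:E.

Lemma quantizer_ge0 i : (0 <= b i)%R.
Proof. by have [_ /(_ i)/ltW] := quant. Qed.

Lemma ge0_integral_quantizer (h : I -> R) : (forall i, 0 <= h i)%R ->
  \int[mu]_y (h (k y))%:E = (\sum_i h i * b i)%:E.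
Proof.
move=> h0; have [mk _ muk _] := quant.
rewrite (ge0_integral_fin_partition _ mk)//; last 2 first.
- apply/measurable_EFinP; rewrite (_ : (fun _ => _) = h \o k)//.
  exact: measurable_comp_fin.
- by move=> y; rewrite lee_fin.
rewrite -sumEFin; apply: eq_bigr => i _.
rewrite (eq_integral (cst (h i)%:E)); last by move=> y; rewrite inE/= => ->.
by rewrite integral_cst// [X in _ * X]muk.
Qed.

Lemma quantizer_sum1 : (\sum_i b i = 1)%R.
Proof.
have e1 : \int[mu]_y (cst 1 y) = 1 :> \bar R.
  by rewrite integral_cst// mul1e; exact: probability_setT.
have [->] := etrans (esym e1) (@ge0_integral_quantizer (fun=> 1%R) (fun=> ler01)).
by apply: eq_bigr => i _; rewrite mul1r.
Qed.

Local Notation weights := (@weights R d I).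
Local Notation residue := (residue m).
Local Notation wbar := (wbar m).
Local Notation wcost := (wcost nu m).
Local Notation wgap := (wgap nu b).
Local Open Scope ring_scope.

Let Phi (lam : I -> R) u :=
  \big[Num.max/ (dotp u (m i0) + lam i0)]_i (dotp u (m i) + lam i).

Let Phi_ge lam u i : dotp u (m i) + lam i <= Phi lam u.
Proof. exact: le_bigmax. Qed.

Let Phi_eq lam u i : (forall j, dotp u (m j) + lam j <= dotp u (m i) + lam i) ->
  Phi lam u = dotp u (m i) + lam i.
Proof.
move=> h; apply/eqP; rewrite eq_le Phi_ge andbT.
by apply: bigmax_le => // j _; exact: h.
Qed.

(** The function G to be fed to the dual inequality: a maximum of affine functions, one per cell
    with multiplier [lam], normalized at 0. The term kap |u|^2 absorbs the distance from y to the
    mean z of its cell, at the price |y - z|^2 / (4 kap). *)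
Let cert (lam : I -> R) (kap : R) u := Phi lam u - Phi lam 0 + kap * dotp u u.

Let conj_le lam kap (y : Rd R d) : 0 < kap ->
  (conjugate setT (cert lam kap) 0%R y <=
  (Phi lam 0 - lam (k y) + (4 * kap)^-1 *
     dotp ((y : 'rV[R]_d) - m (k y)) ((y : 'rV[R]_d) - m (k y)))%R%:E)%E.
Proof.
move=> kap0; apply: ge_ereal_sup => _ [u _ <-]; rewrite lee_fin mul0r addr0 /cert.
have := Phi_ge lam u (k y).
have := dotp_le_sqr 1 u ((y : 'rV[R]_d) - m (k y)) kap0.
rewrite mul1r expr1n mul1r {1}dotpDr dotpNr.
set D2 := dotp (_ - _) _; set k4 := (4 * kap)^-1; lra.
Qed.

Lemma integral_conj_le lam kap : 0 < kap ->
  (\int[mu]_y conjugate setT (cert lam kap) 0%R y <=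
  (Phi lam 0 - \sum_i lam i * b i + delta / (4 * kap))%R%:E)%E.
Proof.
move=> kap0; have [mk _ _ _] := quant.
have lam_le i : lam i <= Phi lam 0 by have := Phi_ge lam 0 i; rewrite dotp0l add0r.
pose h i := Phi lam 0 - lam i; have h0 i : 0 <= h i by rewrite subr_ge0.
have merr : measurable_fun setT (fun y : Rd R d =>
    dotp ((y : 'rV[R]_d) - m (k y)) ((y : 'rV[R]_d) - m (k y))).
  apply: measurable_dotp => l; rewrite (_ : (fun _ => _) =
      (fun y : Rd R d => (y : 'rV[R]_d) 0 l - ((fun i => m i 0 l) \o k) y)).
  1,3: by apply: measurable_funB; [exact: measurable_coord|exact: measurable_comp_fin].
  1,2: by apply/funext => y; rewrite !mxE.
have mh : measurable_fun setT (fun y : Rd R d => h (k y)).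
  by rewrite (_ : (fun _ => _) = h \o k)//; exact: measurable_comp_fin.
have k4 : 0 <= (4 * kap)^-1 by rewrite invr_ge0 mulr_ge0// ltW.
apply: (@le_trans _ _ (\int[mu]_y ((h (k y))%:E + ((4 * kap)^-1)%:E *
    (dotp ((y : 'rV[R]_d) - m (k y)) ((y : 'rV[R]_d) - m (k y)))%:E))%E).
  apply: ge0_le_integral => //.
  - by move=> y _; apply: conjugate_ge0 => //; rewrite /cert dotp0l mulr0 addr0 subrr.
  - exact: measurable_conjugate.
  - apply: emeasurable_funD; first exact/measurable_EFinP.
    by apply: measurable_funeM; exact/measurable_EFinP.
  - by move=> y _; rewrite -EFinM -EFinD; exact: conj_le.
rewrite ge0_integralD//; last 4 first.
- by move=> y _; rewrite lee_fin.
- exact/measurable_EFinP.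
- by move=> y _; rewrite mule_ge0 ?lee_fin// dotpxx_ge0.
- by apply: measurable_funeM; exact/measurable_EFinP.
rewrite ge0_integralZl_EFin//; last 2 first.
- by move=> y _; rewrite lee_fin dotpxx_ge0.
- exact/measurable_EFinP.
rewrite ge0_integral_quantizer// EFinD leeD//.
  rewrite lee_fin /h le_eqVlt; apply/orP; left; apply/eqP.
  under eq_bigr do rewrite mulrBl.
  by rewrite sumrB -mulr_sumr quantizer_sum1 mulr1.
by rewrite [X in (_ <= X%:E)%E]mulrC [X in (_ <= X)%E]EFinM lee_wpmul2l ?lee_fin.
Qed.

(** The dual inequality for [cert], evaluated at u = [residue c x], gives a bound that involves
    [lam] at the best cells; the first-order condition replaces these by c up to e. What remains,
    sum_i lam_i (int c_i dnu - b_i), is minus the penalty since lam_i = - wgap_i / eta, so cost and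
    penalty end up on the same side. *)
Lemma exists_weights_cost_gap eta kap e : 0 < eta -> 0 < kap < 2^-1 -> 0 < e ->
  exists2 c, weights c &
    wcost c + eta^-1 * \sum_i wgap c i ^+ 2 <=
      Ct / (1 - 2 * kap) + delta / (4 * kap) + e.
Proof.
move=> eta0 /andP[kap0 kap1] e0.
have [c wc crit] := exists_almost_critical m nu2 quantizer_sum1 quantizer_ge0 eta0 e0.
exists c => //.
pose lam i := - (eta^-1 * wgap c i).
pose val i x := dotp (residue c x) (m i) + lam i.
have sv j := sqi_residue m nu2 j wc.
have mval i : measurable_fun setT (val i).
  apply: measurable_funD => //; apply: measurable_dotp => j //.
  by have [] := sv j.
have [idx [midx idx_max]] := exists_measurable_argmax i0 mval.
(* The competitor puts all its weight on the cell where [val] is largest, and so realizes the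
   maximum [Phi] at the residue. *)
pose q i x : R := (idx x == i)%:R.
have wq : weights q.
  split => [i|i x|x].
  - rewrite (_ : q i = (fun l => (l == i)%:R) \o idx)//; exact: measurable_comp_fin.
  - by rewrite /q ler0n.
  - rewrite (bigD1 (idx x))//= /q eqxx big1 ?addr0// => i.
    by rewrite eq_sym => /negbTE ->.
have PhiE x : Phi lam (residue c x) = \sum_i q i x * val i x.
  rewrite (@Phi_eq _ _ (idx x)); last exact: idx_max.
  rewrite (bigD1 (idx x))//= /q eqxx mul1r big1 ?addr0// => i.
  by rewrite eq_sym => /negbTE ->; rewrite mul0r.
pose w x : 'rV[R]_d := \sum_i (q i x - c i x) *: m i.
have wE x : w x = wbar q x - wbar c x.
  by rewrite /w /wbar -sumrB; apply: eq_bigr => i _; rewrite scalerBl.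
have sw j : sqintegrable nu (fun x => w x 0 j).
  rewrite (_ : (fun _ => _) = fun x => wbar q x 0 j - wbar c x 0 j).
    by apply: sqintegrableB; exact: sqi_wbar.
  by apply/funext => x; rewrite wE !mxE.
have ivv := integrable_dotp sv sv; have ivw := integrable_dotp sv sw.
have iq i := integrable_weights nu i wq; have ic := fun i => integrable_weights nu i wc.
pose P0 := Phi lam 0.
(* The expression under the supremum of the conjugate at u = [residue c x], written so that its
   integral meets the first-order condition. *)
pose F x := 2^-1 * dotp (residue c x) (residue c x) + P0 -
  dotp (residue c x) (w x) - \sum_i lam i * q i x.
have FE x : F x = dotp (residue c x) x -
    (Phi lam (residue c x) - P0 + 2^-1 * dotp (residue c x) (residue c x)).
  have -> : Phi lam (residue c x) = dotp (residue c x) (wbar q x) + \sum_i lam i * q i x.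
    rewrite PhiE /val; under eq_bigr do rewrite mulrDr.
    rewrite big_split/=; congr (_ + _); last by apply: eq_bigr => i _; rewrite mulrC.
    rewrite {2}/dotp /wbar; under [RHS]eq_bigr do rewrite summxE mulr_sumr.
    rewrite exchange_big/=; apply: eq_bigr => i _.
    rewrite /dotp mulr_sumr; apply: eq_bigr => j _.
    by rewrite [X in _ = _ * X]mxE mulrCA.
  rewrite /F wE dotpDr dotpNr.
  have : dotp (residue c x) x =
      dotp (residue c x) (residue c x) + dotp (residue c x) (wbar c x).
    by rewrite -dotpDr /residue subrK.
  by lra.
have ilq : nu.-integrable setT (EFin \o (fun x => \sum_i lam i * q i x)).
  rewrite (_ : _ \o _ = (fun x => \sum_i (lam i)%:E * (q i x)%:E)%E); last first.
    by apply/funext => x; rewrite /= -sumEFin; apply: eq_bigr => i _; rewrite EFinM.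
  by apply: integrable_sum => // i _; apply: integrableZl => //; exact: iq.
have ihv : nu.-integrable setT
    (EFin \o (fun x => 2^-1 * dotp (residue c x) (residue c x))).
  exact: (integrableZl measurableT 2^-1 ivv).
have iP0 : nu.-integrable setT (EFin \o cst P0) by exact: finite_measure_integrable_cst.
have i1 : nu.-integrable setT
    (EFin \o (fun x => 2^-1 * dotp (residue c x) (residue c x) + cst P0 x)).
  exact: (integrableD measurableT ihv iP0).
have i2 : nu.-integrable setT (EFin \o (fun x =>
    2^-1 * dotp (residue c x) (residue c x) + cst P0 x - dotp (residue c x) (w x))).
  exact: (integrableB measurableT i1 ivw).
have iF : nu.-integrable setT (EFin \o F) by exact: (integrableB measurableT i2 ilq).
have lq : (\int[nu]_x (\sum_i lam i * q i x))%R = \sum_i lam i * \int[nu]_x q i x.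
  rewrite /Rintegral; under eq_integral do rewrite -sumEFin.
  have ilqi i : nu.-integrable setT (fun x => (lam i * q i x)%:E).
    exact: (integrableZl measurableT (lam i) (iq i)).
  rewrite integral_sum// -sum_fine//; last by move=> i _; exact: integrable_fin_num.
  by apply: eq_bigr => i _; exact: (RintegralZl (lam i) measurableT (iq i)).
have EF : (\int[nu]_x F x)%R = wcost c + P0 - (\int[nu]_x dotp (residue c x) (w x))%R -
    \sum_i lam i * \int[nu]_x q i x.
  rewrite -lq (RintegralB measurableT i2 ilq) (RintegralB measurableT i1 ivw).
  rewrite (RintegralD measurableT ihv iP0) (RintegralZl _ measurableT ivv).
  by rewrite Rintegral_cst//= [X in fine X]probability_setT mulr1.
(* Together with the kap |u|^2 inside [cert], a = 1/2 - kap makes the quadratic term |u|^2 / 2,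
   which matches the cost. *)
have a0 : 0 < 2^-1 - kap by rewrite subr_gt0.
have G0 : cert lam kap 0 = 0 by rewrite /cert dotp0l mulr0 addr0 subrr.
have dualG := dual G0 a0.
have Fle : ((\int[nu]_x F x)%R%:E <=
    (P0 - \sum_i lam i * b i + delta / (4 * kap) + Ct / (2 * (2^-1 - kap)))%:E)%E.
  have h1 := leeD (integral_conj_le lam kap0) (lexx (Ct / (2 * (2^-1 - kap)))%:E).
  rewrite EFinD; apply: le_trans h1.
  apply: (le_trans _ dualG); rewrite /Rintegral fineK; last exact: integrable_fin_num.
  apply: integral_le_ge0.
  - by case/integrableP : iF.
  - exact: measurable_conjugate.
  - by move=> x; exact: conjugate_ge0.
  - move=> x; apply: le_trans (conjugate_ge _ _ _ (Logic.I : setT (residue c x))).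
    by rewrite lee_fin FE /cert -/P0; lra.
have := crit q wq; rewrite -/(w _).
have -> : eta^-1 * \sum_i wgap c i * \int[nu]_x (q i x - c i x) =
    - (\sum_i lam i * \int[nu]_x q i x) + \sum_i lam i * \int[nu]_x c i x.
  rewrite mulr_sumr -sumrN -big_split/=; apply: eq_bigr => i _.
  by rewrite (RintegralB measurableT (iq i) (ic i)) /lam; ring.
have -> : eta^-1 * \sum_i wgap c i ^+ 2 =
    - (\sum_i lam i * \int[nu]_x c i x) + \sum_i lam i * b i.
  rewrite mulr_sumr -sumrN -big_split/=; apply: eq_bigr => i _.
  by rewrite /lam /wgap; ring.
have -> : 1 - 2 * kap = 2 * (2^-1 - kap) by field.
move: Fle; rewrite EF lee_fin; lra.
Qed.

End dual_certificate.

(** * Repair of the second marginal and strong duality *)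

Section strong_duality.
Context {R : realType} {d : nat}.
Variables (mu nu : probability (Rd R d) R).
Hypotheses (mu2 : \int[mu]_x (dotp x x)%:E < +oo)
  (nu2 : \int[nu]_x (dotp x x)%:E < +oo).
Local Open Scope ring_scope.

Section repair.
Variables (I : finType) (k : Rd R d -> I) (b : I -> R) (m : I -> 'rV[R]_d).
Hypothesis quant : quantizer mu k b m.

(** A bound on the cost of any weights, from |x - z|^2 / 2 <= |x|^2 + |z|^2. *)
Let spread : R := (\int[nu]_x dotp x x)%R + \sum_(j < d) (\sum_i `|m i 0 j|) ^+ 2.

Let ixx : nu.-integrable setT (fun x : Rd R d => (dotp x x)%:E).
Proof. by apply: integrable_dotp => j; exact: sqintegrable_coord. Qed.

Let spread_ge0 : 0 <= spread.
Proof.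
rewrite addr_ge0 ?sumr_ge0// => [|j _]; last exact: sqr_ge0.
by apply: Rintegral_ge0 => x _; exact: dotpxx_ge0.
Qed.

Lemma wcost_le_spread c : weights c -> wcost nu m c <= spread.
Proof.
move=> wc; have sv j := sqi_residue m nu2 j wc.
set S := \sum_(j < d) (\sum_i `|m i 0 j|) ^+ 2.
have iS : nu.-integrable setT (EFin \o cst S) by exact: finite_measure_integrable_cst.
rewrite /wcost -RintegralZl//; last exact: integrable_dotp.
rewrite (_ : spread = (\int[nu]_x (dotp x x + cst S x))%R); last first.
  rewrite (RintegralD measurableT ixx iS).
  by rewrite Rintegral_cst//= [X in fine X]probability_setT mulr1.
apply: le_Rintegral => //.
- exact: (integrableZl measurableT 2^-1 (integrable_dotp sv sv)).
- exact: (integrableD measurableT ixx iS).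
move=> x _; rewrite /S /dotp -big_split/= mulr_sumr; apply: ler_sum => j _.
have wle : wbar m c x 0 j ^+ 2 <= (\sum_i `|m i 0 j|) ^+ 2.
  rewrite -real_normK ?num_real// lerXn2r ?nnegrE ?sumr_ge0//.
  rewrite /wbar summxE (le_trans (ler_norm_sum _ _ _))//.
  apply: ler_sum => i _; rewrite mxE normrM ler_piMl// ger0_norm ?weights_le1//.
  by have [_ c0 _] := wc.
have -> : residue m c x 0 j = (x : 'rV[R]_d) 0 j - wbar m c x 0 j by rewrite 2!mxE.
have := sqr_ge0 ((x : 'rV[R]_d) 0 j + wbar m c x 0 j).
by move: wle; set S' := (\sum_i _) ^+ 2; nra.
Qed.

Lemma wcost_mix t c q : 0 <= t <= 1 -> weights c -> weights q ->
  wcost nu m (mix_weights t c q) <= (1 - t) * wcost nu m c + t * wcost nu m q.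
Proof.
move=> t01 wc wq; have /andP[t0 t1] := t01.
have wt := weights_mix t01 wc wq.
have sv j := sqi_residue m nu2 j wc; have sq j := sqi_residue m nu2 j wq.
have st j := sqi_residue m nu2 j wt.
have iv := integrable_dotp sv sv; have iq := integrable_dotp sq sq.
have it := integrable_dotp st st.
have iv' := integrableZl measurableT (1 - t) iv; have iq' := integrableZl measurableT t iq.
have res x : residue m (mix_weights t c q) x =
    (1 - t) *: residue m c x + t *: residue m q x.
  rewrite /residue.
  have -> : wbar m (mix_weights t c q) x = (1 - t) *: wbar m c x + t *: wbar m q x.
    rewrite /wbar !scaler_sumr -big_split/=; apply: eq_bigr => i _.
    by rewrite !scalerA -scalerDl; congr (_ *: _); rewrite /mix_weights; ring.
  set z1 := wbar m c x; set z2 := wbar m q x.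
  by apply/rowP => j; rewrite !mxE; ring.
rewrite /wcost mulrCA [t * _]mulrCA -mulrDr ler_wpM2l//.
rewrite -(RintegralZl _ measurableT iv) -(RintegralZl _ measurableT iq).
rewrite -(RintegralD measurableT iv' iq').
apply: le_Rintegral => //; first exact: (integrableD measurableT iv' iq').
move=> x _; rewrite res; move: (residue m c x) (residue m q x) => u v.
rewrite /dotp !mulr_sumr -big_split/=; apply: ler_sum => j _.
rewrite !mxE; move: (u 0 j) (v 0 j) => a b'.
have : 0 <= t * (1 - t) * (a - b') ^+ 2.
  by rewrite mulr_ge0 ?sqr_ge0// mulr_ge0// subr_ge0.
lra.
Qed.

Lemma weak_cost_le_wcost c : weights c ->
  (forall i, (\int[nu]_x c i x)%R = b i) ->
  (weak_cost mu nu <= (wcost nu m c)%:E)%E.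
Proof.
move=> wc Ec; have [mk b0 muk mukm] := quant; have [mc c0 c1] := wc.
have sv j := sqi_residue m nu2 j wc.
have iv := integrable_dotp sv sv.
apply: (le_trans (weak_cost_le_weights mk b0 muk c0 c1 mc _ _ mukm)).
- move=> i; rewrite -Ec /Rintegral fineK//.
  by apply: integrable_fin_num => //; exact: integrable_weights.
- by move=> j; exact: (sqintegrable_integrable (sqintegrable_coord mu2 j)).
rewrite /wcost -RintegralZl// /Rintegral fineK; last first.
  apply: integrable_fin_num => //; exact: (integrableZl measurableT 2^-1 iv).
by rewrite le_eqVlt; apply/orP; left; apply/eqP; apply: eq_integral => x _;
  rewrite eucl_norm_sqr.
Qed.

(* A plan whose second marginal is off by a small relative amount is mixed with
   the constant plan that restores the marginal exactly. *)
Lemma repair_weights t c : 0 < t <= 2^-1 -> weights c ->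
  (forall i, `|wgap nu b c i| <= t * b i) ->
  (weak_cost mu nu <= (wcost nu m c + t * spread)%:E)%E.
Proof.
move=> /andP[t0 t1] wc gapt.
have b1 := quantizer_sum1 quant; have [_ c0 c1] := wc.
have ic i := integrable_weights nu i wc.
pose Ec i := (\int[nu]_x c i x)%R.
(* The solution of (1 - t) [Ec i] + t [r i] = [b i]. It is nonnegative because [Ec i] is at most (1
   + t) [b i] and (1 - t) (1 + t) <= 1. *)
pose r i := (b i - (1 - t) * Ec i) / t.
have r0 i : 0 <= r i.
  rewrite divr_ge0 ?(ltW t0)//; have := gapt i; rewrite ler_norml => /andP[_].
  have := quantizer_ge0 quant i; rewrite /wgap -/(Ec i); nra.
have EcS : \sum_i Ec i = 1.
  rewrite /Ec /Rintegral sum_fine; last first.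
    by move=> i _; apply: integrable_fin_num => //; exact: ic.
  rewrite -integral_sum//.
  rewrite (eq_integral (cst 1%E)).
    by rewrite integral_cst// mul1e [X in fine X]probability_setT.
  by move=> x _; rewrite sumEFin c1.
have wr : weights (fun i (_ : Rd R d) => r i).
  split => //= x; rewrite -mulr_suml sumrB b1 -mulr_sumr EcS mulr1.
  by rewrite opprB addrC subrK divff// gt_eqF.
have t01 : 0 <= t <= 1 by apply/andP; split; lra.
have wt := weights_mix t01 wc wr.
have icr i : nu.-integrable setT (EFin \o cst (r i)).
  exact: finite_measure_integrable_cst.
have Et i : (\int[nu]_x mix_weights t c (fun i _ => r i) i x)%R = b i.
  have ird : nu.-integrable setT (EFin \o (fun x => r i - c i x)).
    exact: (integrableB measurableT (icr i) (ic i)).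
  rewrite /mix_weights (RintegralD measurableT (ic i) (integrableZl measurableT t ird)).
  rewrite (RintegralZl _ measurableT ird) (RintegralB measurableT (icr i) (ic i)).
  rewrite Rintegral_cst//= [X in fine X]probability_setT mulr1 -/(Ec i) /r.
  by field; rewrite gt_eqF.
apply: le_trans (weak_cost_le_wcost wt Et) _; rewrite lee_fin.
apply: (le_trans (wcost_mix t01 wc wr)).
have := wcost_le_spread wr; have : 0 <= wcost nu m c.
  by rewrite mulr_ge0// Rintegral_ge0// => x _; exact: dotpxx_ge0.
by nra.
Qed.

Lemma weak_cost_le_gap (T : R) : 0 <= T ->
  (forall eta, 0 < eta -> exists2 c, weights c &
    wcost nu m c + eta^-1 * \sum_i wgap nu b c i ^+ 2 <= T) ->
  (weak_cost mu nu <= T%:E)%E.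
Proof.
move=> T0 H; apply/lee_addgt0Pr => e e0.
have [_ b0 _ _] := quant.
pose t := Num.min 2^-1 (e / (spread + 1)).
have s1 : 0 < spread + 1 by rewrite ltr_wpDl.
have t0 : 0 < t by rewrite lt_min divr_gt0// andbT invr_gt0.
have ts : t * spread <= e.
  apply: (@le_trans _ _ (t * (spread + 1))); first by rewrite ler_wpM2l ?(ltW t0)// lerDl.
  by rewrite -ler_pdivlMr// ge_min lexx orbT.
pose bm := \big[Num.min/1]_i b i.
have bm0 : 0 < bm by apply: lt_bigmin => // i _; exact: b0.
have bmb i : bm <= b i by exact: bigmin_le.
(* The penalty bounds each squared gap by eta T, which this choice keeps below (t bm)^2, hence each
   gap below t b_i; T + 1 avoids dividing by 0. *)
pose eta := (t * bm) ^+ 2 / (T + 1).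
have T1 : 0 < T + 1 by rewrite ltr_wpDl.
have eta0 : 0 < eta by rewrite divr_gt0// exprn_gt0// mulr_gt0.
have [c wc cT] := H _ eta0.
have cost0 : 0 <= wcost nu m c.
  by rewrite mulr_ge0// Rintegral_ge0// => x _; exact: dotpxx_ge0.
have sum0 : 0 <= eta^-1 * \sum_i wgap nu b c i ^+ 2.
  by rewrite mulr_ge0 ?invr_ge0 ?(ltW eta0)// sumr_ge0// => i _; exact: sqr_ge0.
have gapt i : `|wgap nu b c i| <= t * b i.
  apply: (@le_trans _ _ (t * bm)); last by rewrite ler_wpM2l// ltW.
  rewrite -(@ler_pXn2r _ 2)// ?nnegrE ?mulr_ge0 ?(ltW t0) ?(ltW bm0)//.
  rewrite real_normK ?num_real//.
  apply: (@le_trans _ _ (\sum_i wgap nu b c i ^+ 2)).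
    by rewrite (bigD1 i)//= lerDl sumr_ge0// => j _; exact: sqr_ge0.
  apply: (@le_trans _ _ (eta * T)).
    by rewrite -ler_pdivrMl//; lra.
  rewrite /eta mulrAC ler_pdivrMr// ler_wpM2l ?sqr_ge0//; lra.
have t12 : 0 < t <= 2^-1 by rewrite t0 ge_min lexx.
apply: le_trans (repair_weights t12 wc gapt) _.
by rewrite -EFinD lee_fin; lra.
Qed.

End repair.

Theorem weak_cost_le_dual (Ct : R) : 0 <= Ct ->
  (forall (G : 'rV[R]_d -> R) (a : R), G 0 = 0 -> 0 < a ->
    (\int[nu]_x conjugate setT G a x <=
    \int[mu]_x conjugate setT G 0%R x + (Ct / (2 * a))%:E)%E) ->
  (weak_cost mu nu <= Ct%:E)%E.
Proof.
move=> Ct0 dual; apply/lee_addgt0Pr => e e0.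
(* For kap <= 1/4 one has 1 / (1 - 2 kap) <= 1 + 4 kap, so the loss on Ct is at most e / 3. The
   quantization error kap e, fixed after kap, contributes e / 4, and the first-order defect e /
   3. *)
pose kap := Num.min 4^-1 (e / (12 * (Ct + 1))).
have C1 : 0 < Ct + 1 by rewrite ltr_wpDl.
have kap0 : 0 < kap by rewrite lt_min divr_gt0 ?mulr_gt0// andbT invr_gt0.
have kap4 : kap <= 4^-1 by rewrite ge_min lexx.
have kapC : 4 * kap * Ct <= e / 3.
  have : kap * (12 * (Ct + 1)) <= e by rewrite -ler_pdivlMr ?mulr_gt0// ge_min lexx orbT.
  by nra.
have [I [k [b [m [quant err]]]]] := exists_quantizer mu2 (mulr_gt0 kap0 e0).
have kap01 : 0 < kap < 2^-1 by rewrite kap0 (le_lt_trans kap4)//; lra.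
have k2 : 0 < 1 - 2 * kap by lra.
have bound : Ct / (1 - 2 * kap) + kap * e / (4 * kap) + e / 3 <= Ct + e.
  have -> : kap * e / (4 * kap) = e / 4 by field; rewrite gt_eqF.
  have : Ct / (1 - 2 * kap) <= Ct + e / 3.
    by rewrite ler_pdivrMr//; nra.
  lra.
rewrite -EFinD; apply: (weak_cost_le_gap quant); first by rewrite addr_ge0// ltW.
move=> eta eta0.
have e3 : 0 < e / 3 by rewrite divr_gt0.
have [c wc cT] := exists_weights_cost_gap (k 0) nu2 quant err dual eta0 kap01 e3.
by exists c => //; exact: le_trans bound.
Qed.

End strong_duality.

(** * Mixtures *)

Lemma rel_entropy_ge0 (R : realType) d (nu mu : probability (Rd R d) R) :
  0 <= rel_entropy nu mu.
Proof.
have [numu|nonumu] := pselect (nu `<< mu); last first.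
  by rewrite /rel_entropy asboolF.
have [f [f0 mf nuf]] := density_of_dominates numu.
rewrite (rel_entropy_density f0 mf nuf); apply: integral_ge0 => x _.
by rewrite lee_fin entf_ge0.
Qed.

Lemma weak_cost_ge0 (R : realType) d (mu2 mu1 : probability (Rd R d) R) :
  0 <= weak_cost mu2 mu1.
Proof.
apply/ereal_infP => _ [pi [p [_ _ ->]]]; apply: integral_ge0 => x _.
by rewrite lee_fin mulr_ge0// sqr_ge0.
Qed.

Lemma T2minus_const_ge0 (R : realType) d (mu : probability (Rd R d) R) :
  0 <= T2minus_const mu.
Proof. by apply/ereal_infP => _ [C [C0 _] <-]; rewrite lee_fin ltW. Qed.

Section mixture_T2minus.
Context {R : realType} {d : nat} {dT : measure_display}.
Variables (Theta : measurableType dT) (m : probability Theta R)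
  (mu : Theta -> probability (Rd R d) R) (hmu : measurable_family mu).
Variable K : R.
Hypotheses (K0 : (0 < K)%R) (P1mu : forall t, P1 (mu t)).
Hypothesis T2mu : forall t nu, P1 nu ->
  weak_cost (mu t) nu <= (K / 2)%:E * rel_entropy nu (mu t).
Hypothesis costmu : forall t t', weak_cost (mu t) (mu t') <= (K / 4)%:E.
Variable t0 : Theta.

Let axis (s : bool) (i : 'I_d) : 'rV[R]_d := ((-1) ^+ s *: delta_mx 0 i)%R.

Let dotp_axis s i x : dotp (axis s i) x = ((-1) ^+ s * x 0%R i)%R.
Proof.
rewrite /dotp (bigD1 i)//= !mxE !eqxx mulr1 big1 ?addr0// => j /negbTE ji.
by rewrite !mxE ji andbF mulr0 mul0r.
Qed.

Let axis_unit s i : dotp (axis s i) (axis s i) = 1%R.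
Proof. by rewrite dotp_axis !mxE !eqxx mulr1 -expr2 sqrr_sign. Qed.

Let dotp_posdot (x : Rd R d) :
  dotp x x = (\sum_(i < d) (posdot (axis false i) x ^+ 2 + posdot (axis true i) x ^+ 2))%R.
Proof.
apply: eq_bigr => i _; rewrite /posdot !dotp_axis expr0 expr1 mul1r mulN1r.
rewrite /Num.max oppr_lt0; case: ltgtP => h; first by ring.
  by ring.
by rewrite h; ring.
Qed.

Let mom s i := fine (\int[mu t0]_x (posdot (axis s i) x)%:E).

Let momE s i : \int[mu t0]_x (posdot (axis s i) x)%:E = (mom s i)%:E.
Proof.
rewrite fineK// ge0_fin_numE; last first.
  by apply: integral_ge0 => x _; rewrite lee_fin posdot_ge0.
apply: le_lt_trans (P1mu t0); apply: ge0_le_integral => //.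
- by move=> x _; rewrite lee_fin posdot_ge0.
- by apply/measurable_EFinP; exact: measurable_posdot.
- by apply/measurable_EFinP; apply: measurable_eucl_norm => j; exact: measurable_coord.
- move=> x _; rewrite lee_fin ge_max eucl_norm_ge0 andbT dotp_axis.
  apply: le_trans (ler_norm _) _; rewrite normrM normrX normrN1 expr1n mul1r.
  exact: coord_le_eucl_norm.
Qed.

Let mposdot_sqr u : measurable_fun setT (fun x : Rd R d => (posdot u x ^+ 2)%:E).
Proof. by apply/measurable_EFinP; apply: measurable_funX; exact: measurable_posdot. Qed.

Let mdotpE : measurable_fun setT (fun x : Rd R d => (dotp x x)%:E).
Proof. by apply/measurable_EFinP; apply: measurable_dotp => i; exact: measurable_coord. Qed.

(** Every mu_t is compared with the fixed mu_t0: by [integral_posdot_le] with a = 1 its directional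
    first moments exceed those of mu_t0 by at most 1 + K / 8, and [integral_posdot_sqr] applies with
    C = K / 2. The result is independent of t. *)
Let bound s i : R := (2 * expR (mom s i + (1 + K / 4 / (2 * 1)) + K / 2 / 2))%R.

Lemma second_moment_le t : \int[mu t]_x (dotp x x)%:E <=
  (\sum_(i < d) (bound false i + bound true i))%:E.
Proof.
have sqr_le s i : \int[mu t]_x (posdot (axis s i) x ^+ 2)%:E <= (bound s i)%:E.
  apply: integral_posdot_sqr => //.
  - by rewrite divr_gt0.
  - exact: T2mu.
  - by rewrite EFinD -momE; apply: integral_posdot_le.
rewrite (eq_integral (fun x : Rd R d => \sum_(i < d)
    ((posdot (axis false i) x ^+ 2)%:E + (posdot (axis true i) x ^+ 2)%:E))); last first.
  move=> x _; rewrite dotp_posdot -sumEFin; apply: eq_bigr => i _.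
  by rewrite EFinD.
rewrite ge0_integral_sum//; last 2 first.
- by move=> i; apply: emeasurable_funD.
- by move=> i x _; rewrite adde_ge0 ?lee_fin ?sqr_ge0.
rewrite -sumEFin; apply: lee_sum => i _.
rewrite ge0_integralD//; last 2 first.
- by move=> x _; rewrite lee_fin sqr_ge0.
- by move=> x _; rewrite lee_fin sqr_ge0.
by rewrite EFinD leeD.
Qed.

Lemma second_moment_mixture : \int[mixture m hmu]_x (dotp x x)%:E < +oo.
Proof.
rewrite ge0_integral_mix//; last by move=> x; rewrite lee_fin dotpxx_ge0.
apply: (@le_lt_trans _ _ (\int[m]_t
    (cst (\sum_(i < d) (bound false i + bound true i))%:E t))).
  apply: ge0_le_integral => //.
  - by move=> t _; apply: integral_ge0 => x _; rewrite lee_fin dotpxx_ge0.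
  - by apply: measurable_integral_mu => // x; rewrite lee_fin dotpxx_ge0.
  - by move=> t _; exact: second_moment_le.
by rewrite integral_cst// [X in _ * X]probability_setT mule1 ltry.
Qed.

Lemma P1_mixture : P1 (mixture m hmu).
Proof.
rewrite /P1; apply: (@le_lt_trans _ _ (\int[mixture m hmu]_x (1 + (dotp x x)%:E))).
  apply: ge0_le_integral => //.
  - by move=> x _; rewrite lee_fin eucl_norm_ge0.
  - by apply/measurable_EFinP; apply: measurable_eucl_norm => i; exact: measurable_coord.
  - exact: emeasurable_funD.
  - by move=> x _; rewrite -EFinD lee_fin eucl_norm_le_sqr.
rewrite ge0_integralD//; last by move=> x _; rewrite lee_fin dotpxx_ge0.
rewrite integral_cst// mul1e [X in X + _]probability_setT.
by rewrite lte_add_pinfty ?ltry// second_moment_mixture.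
Qed.

(* The conjugate of a quadratic function is quadratic. *)
Lemma second_moment_of_entropy nu : P1 nu -> nu `<< mixture m hmu ->
  rel_entropy nu (mixture m hmu) < +oo -> \int[nu]_x (dotp x x)%:E < +oo.
Proof.
move=> P1nu numix Hfin.
(* At s = 0 the conjugate is |x|^2 / 2; at s = 1/2 it is |x|^2 / 4, attained at u = x / 2. The dual
   inequality thus bounds a quarter of the second moment of nu. *)
pose G (u : 'rV[R]_d) : R := (2^-1 * dotp u u)%R.
have G0 : G 0%R = 0%R by rewrite /G dotp0l mulr0.
have a0 : (0 < 2^-1 :> R)%R by rewrite invr_gt0.
have := @mixture_weak_duality R d dT Theta m mu hmu setT G I G0 K K0 P1mu T2mu costmu
  nu 2^-1%R a0 P1nu numix.
have fin_rhs : \int[mixture m hmu]_x conjugate setT G 0 x +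
    (K / (2 * 2^-1))%:E * rel_entropy nu (mixture m hmu) < +oo.
  rewrite lte_add_pinfty//; last first.
    apply: lte_mul_pinfty => //; rewrite lee_fin.
    by rewrite divr_ge0 ?mulr_ge0 ?invr_ge0 ?(ltW K0)//.
  apply: le_lt_trans second_moment_mixture; apply: ge0_le_integral => //.
  - by move=> x _; exact: conjugate_ge0.
  - exact: measurable_conjugate.
  - move=> x _; apply: ge_ereal_sup => _ [u _ <-]; rewrite lee_fin mul0r addr0 /G.
    have := dotp_le_sqr 1%R u x a0; have := dotpxx_ge0 x.
    rewrite mul1r expr1n; have -> : (1 / (4 * 2^-1) = 2^-1 :> R)%R by field.
    lra.
move=> /le_lt_trans/(_ fin_rhs) fin4.
have fin_int : (4^-1)%:E * \int[nu]_x (dotp x x)%:E < +oo.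
  apply: le_lt_trans fin4; rewrite -ge0_integralZl_EFin//; last first.
    by move=> x _; rewrite lee_fin dotpxx_ge0.
  apply: ge0_le_integral => //.
  - by move=> x _; rewrite mule_ge0// lee_fin dotpxx_ge0.
  - exact: measurable_funeM.
  - exact: measurable_conjugate.
  - move=> x _; apply: le_trans (conjugate_ge _ _ _ (I : setT (2^-1 *: (x : 'rV[R]_d)))).
    have -> : dotp (2^-1 *: (x : 'rV[R]_d)) x = (2^-1 * dotp x x)%R.
      by rewrite /dotp mulr_sumr; apply: eq_bigr => i _; rewrite mxE mulrA.
    have -> : dotp (2^-1 *: (x : 'rV[R]_d)) (2^-1 *: (x : 'rV[R]_d)) = (4^-1 * dotp x x)%R.
      by rewrite /dotp mulr_sumr; apply: eq_bigr => i _; rewrite !mxE; field.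
    rewrite -EFinM lee_fin /G.
    have -> : dotp (2^-1 *: (x : 'rV[R]_d)) (2^-1 *: (x : 'rV[R]_d)) = (4^-1 * dotp x x)%R.
      by rewrite /dotp mulr_sumr; apply: eq_bigr => i _; rewrite !mxE; field.
    lra.
have -> : \int[nu]_x (dotp x x)%:E = 4%:E * ((4^-1)%:E * \int[nu]_x (dotp x x)%:E).
  by rewrite muleA -EFinM divff// mul1e.
by rewrite lte_mul_pinfty// lee_fin.
Qed.

Lemma T2minus_mixture : T2minus (mixture m hmu) K.
Proof.
split; first exact: P1_mixture.
move=> nu P1nu.
have H0 := rel_entropy_ge0 nu (mixture m hmu).
have [numix|nonumix] := pselect (nu `<< mixture m hmu); last first.
  by rewrite [X in _ * X]/rel_entropy asboolF// gt0_muley ?lte_fin// leey.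
have [Hoo|Hfin] := leP +oo (rel_entropy nu (mixture m hmu)).
  by move: Hoo; rewrite leye_eq => /eqP ->; rewrite gt0_muley ?lte_fin// leey.
have HE : (fine (rel_entropy nu (mixture m hmu)))%:E = rel_entropy nu (mixture m hmu).
  by rewrite fineK// ge0_fin_numE.
rewrite -HE -EFinM; apply: weak_cost_le_dual.
- exact: second_moment_mixture.
- exact: second_moment_of_entropy.
- by rewrite mulr_ge0 ?(ltW K0)// fine_ge0.
- move=> G a G0 a0; rewrite mulrAC EFinM HE.
  exact: mixture_weak_duality.
Qed.

End mixture_T2minus.

Theorem theorem2p6 (R : realType) (d : nat) (dT : measure_display)
    (Theta : measurableType dT) (m : probability Theta R)
    (mu : Theta -> probability (Rd R d) R) (hmu : measurable_family mu)
    (CTheta DTheta : \bar R)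
    (defC : CTheta = ereal_sup [set T2minus_const (mu t) | t in [set: Theta]])
    (defD : DTheta = ereal_sup [set weak_cost (mu t) (mu t')
                               | t in [set: Theta] & t' in [set: Theta]])
    (finC : CTheta < +oo) (finD : DTheta < +oo) :
  (exists2 C : R, (0 < C)%R & T2minus (mixture m hmu) C) /\
  T2minus_const (mixture m hmu) <= maxe (2%:E * CTheta) (4%:E * DTheta).
Proof.
have [t0 _] : exists t : Theta, True.
  apply: contrapT => noT; have := @probability_setT _ _ _ m.
  rewrite (_ : setT = set0) ?measure0; last first.
    by apply/seteqP; split => // t _; apply: noT; exists t.
  by move=> /eqP; rewrite eq_sym onee_eq0.
have constC t : T2minus_const (mu t) <= CTheta.
  by rewrite defC; apply: ereal_sup_ubound; exists t.
have costD t t' : weak_cost (mu t) (mu t') <= DTheta.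
  by rewrite defD; apply: ereal_sup_ubound; exists t => //; exists t'.
have C0 : 0 <= CTheta by apply: le_trans (constC t0); exact: T2minus_const_ge0.
have D0 : 0 <= DTheta by apply: le_trans (costD t0 t0); exact: weak_cost_ge0.
move: CTheta DTheta C0 D0 constC costD finC finD {defC defD} => [c| |] [dd| |]//.
move=> C0 D0 constC costD _ _.
rewrite -!EFinM -EFin_max; set M := Num.max _ _.
have M0 : (0 <= M)%R by rewrite le_max mulr_ge0.
(* The slack e makes the constant positive even if M = 0, and c < (M + e) / 2 strict, so that the
   infimum [T2minus_const (mu t)] leaves room for an admissible constant below (M + e) / 2; entropy
   being nonnegative, that constant may be enlarged. *)
have T2K e : (0 < e)%R -> T2minus (mixture m hmu) (M + e).
  move=> e0; have K0 : (0 < M + e)%R by rewrite ltr_wpDl.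
  have cK : (c < (M + e) / 2)%R.
    by have : (2 * c <= M)%R; [rewrite le_max lexx|lra].
  have dK : (dd <= (M + e) / 4)%R.
    by have : (4 * dd <= M)%R; [rewrite le_max lexx orbT|lra].
  have T2t t : exists2 C, (C < (M + e) / 2)%R & T2minus (mu t) C.
    have : T2minus_const (mu t) < ((M + e) / 2)%:E.
      by apply: le_lt_trans (constC t) _; rewrite lte_fin.
    by move=> /ereal_inf_lt[_ [C [_ T2C] <-]]; rewrite lte_fin => CK; exists C.
  apply: T2minus_mixture => //.
  - by move=> t; have [C _ []] := T2t t.
  - move=> t nu P1nu; have [C CK [_ T2C]] := T2t t.
    apply: le_trans (T2C _ P1nu) _.
    by rewrite lee_wpmul2r ?rel_entropy_ge0// lee_fin ltW.
  - by move=> t t'; apply: le_trans (costD t t') _; rewrite lee_fin.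
split; first by exists (M + 1)%R; [rewrite ltr_wpDl|exact: T2K].
apply/lee_addgt0Pr => e e0; rewrite -EFinD; apply: ereal_inf_lbound.
by exists (M + e)%R => //; split; [rewrite ltr_wpDl|exact: T2K].
Qed.
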